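(* Let $n\ge2$ and let $d$ be the $\ell^q$ distance on $\mathbb{Z}^n$ for any $q\in[1,\infty]$. In each of the two cases (a.i) only non-backtracking paths are permitted, and (a.ii) all simple paths are permitted, the Rough Mount Fuji accessibility percolation critical values on $\mathbb{Z}^n$ satisfy \[0<\theta_c\le\theta_c'<1.\]
   Context: Consider the integer lattice $\mathbb{Z}^n$ with nearest-neighbour edges and root $0$. Rough Mount Fuji (RMF) labels: for $\theta\in[0,1]$, let $\{U_v:v\in\mathbb{Z}^n\}$ be i.i.d. Uniform$(0,1)$ and set $X_v=U_v+\theta\,d(0,v)$, where $d(x,y)=\|x-y\|_q$. Permitted paths: simple nearest-neighbour paths $x_0=0,x_1,x_2,\ldots$; in case (a.ii) there is no further restriction; in case (a.i), the non-backtracking case, each step must move further away from the origin in the graph ($\ell^1$) distance, i.e. $\|x_{j+1}\|_1>\|x_j\|_1$ for every $j$. (For $q<\infty$ this is equivalent to $d(0,x_{j+1})>d(0,x_j)$ for each $j$; in the first quadrant/orthant these are the paths whose coordinates never decrease.) A path is increasing if $X_{x_0}<X_{x_1}<\cdots$. RMF accessibility percolation is the event that there is an infinite permitted increasing path from $0$; write $\mathbb{P}_\theta$ for the probability with parameter $\theta$. Define \[\theta_c=\inf\{\theta\in[0,1]:\mathbb{P}_\theta(\text{RMF accessibility percolation})>0\},\] \[\theta_c'=\sup\{\theta\in[0,1]:\mathbb{P}_\theta(\text{RMF accessibility percolation})=0\}.\] These depend on $d$, $n$ and the choice (a.i) or (a.ii). *)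

(* Defs.v *)
From HB Require Import structures.
From mathcomp Require Import all_boot all_order all_algebra.
From mathcomp Require Import all_classical all_reals all_analysis.

Set Implicit Arguments.
Unset Strict Implicit.
Unset Printing Implicit Defensive.

Import Order.TTheory GRing.Theory Num.Theory.
Import numFieldNormedType.Exports.
Local Open Scope classical_set_scope.
Local Open Scope ring_scope.

Section Lattice.
Variable n : nat.

(* l^1 norm; |y - x|_1 is the graph distance of the nearest-neighbour graph *)
Definition l1norm (x : 'rV[int]_n) : nat := (\sum_(i < n) `|x 0%R i|)%N.

Definition adjacent (x y : 'rV[int]_n) : Prop := l1norm (y - x) = 1%N.

(* The value at q = -oo is a dummy: only 1 <= q <= +oo is meaningful. *)
Definition lq_norm (R : realType) (q : \bar R) (x : 'rV[int]_n) : R :=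
  match q with
  | r%:E => (\sum_(i < n) (`|x 0 i|%:~R `^ r)) `^ r^-1
  | +oo%E => \big[Num.max/0]_(i < n) `|x 0 i|%:~R
  | -oo%E => 0
  end.

Definition lq_dist (R : realType) (q : \bar R) (x y : 'rV[int]_n) : R :=
  lq_norm q (x - y).

End Lattice.

Section Independence.
Context (d : measure_display) (T : measurableType d) (R : realType).
Variable P : probability T R.

Definition mutually_independent (I : eqType) (X : I -> {RV P >-> R}) : Prop :=
  forall (s : seq I) (A : I -> set R), uniq s ->
    (forall i, measurable (A i)) ->
    P (\big[setI/setT]_(i <- s) (X i @^-1` A i)) =
    (\prod_(i <- s) P (X i @^-1` A i))%E.

Definition iid_uniform01 (I : eqType) (U : I -> {RV P >-> R}) : Prop :=
  mutually_independent U /\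
  forall (i : I) (A : set R), measurable A ->
    distribution P (U i) A = uniform_prob (@ltr01 R) A.

End Independence.

Inductive path_rule : Type := NonBacktracking | AllSimple.

Definition permitted (n : nat) (c : path_rule) (x : nat -> 'rV[int]_n) : Prop :=
  [/\ x 0%N = 0,
      forall j, adjacent (x j) (x j.+1),
      injective x &
      match c with
      | NonBacktracking => forall j, (l1norm (x j) < l1norm (x j.+1))%N
      | AllSimple => True
      end].

Section RoughMountFuji.
Context (d : measure_display) (T : measurableType d) (R : realType).
Context (P : probability T R) (n : nat) (U : 'rV[int]_n -> {RV P >-> R}).
Variables (q : \bar R) (c : path_rule).

Definition rmf_label (theta : R) (v : 'rV[int]_n) (w : T) : R :=
  U v w + theta * lq_dist q 0 v.

Definition rmf_percolation (theta : R) : set T :=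
  [set w | exists2 x : nat -> 'rV[int]_n, permitted c x &
     forall j, rmf_label theta (x j) w < rmf_label theta (x j.+1) w].

Definition theta_c : R :=
  inf [set theta : R | 0 <= theta <= 1 /\ (0 < P (rmf_percolation theta))%E].

Definition theta_c' : R :=
  sup [set theta : R | 0 <= theta <= 1 /\ P (rmf_percolation theta) = 0%E].

End RoughMountFuji.

(* Main.v *)
Require Import Defs.
From HB Require Import structures.
From mathcomp Require Import all_boot all_order all_algebra.
From mathcomp Require Import all_classical all_reals all_analysis.
From mathcomp Require Import measurable_realfun.
From mathcomp Require Import zify ring lra.

Set Implicit Arguments.
Unset Strict Implicit.
Unset Printing Implicit Defensive.

Import Order.TTheory GRing.Theory Num.Theory.
Import numFieldNormedType.Exports.
Local Open Scope classical_set_scope.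
Local Open Scope ring_scope.

(** Because labels strictly increase along an accessible path, such a path cannot
revisit a site, and since each site has finitely many neighbours an infinite
increasing path exists as soon as there are increasing paths of every finite
length (Koenig's lemma, [climbs_forever_path]).  This makes the percolation
event measurable.

The inequality between the two critical values is formal: every parameter of
the unit interval lies in one of the two sets whose infimum and supremum are compared, so
no parameter fits strictly between the supremum and the infimum.  What has to be
proved is that percolation has probability zero for all small parameters
([percolation_null]) and positive probability for all parameters close to one
([percolation_positive]).

Small parameters.  A step changes the l^q distance to the origin by at most one,
so along an increasing path the uniform variables never drop by more than theta.
If theta <= 1/k, then after cutting the unit interval into k cells of length 1/k
the cell index drops by at most one per step.  There are at most a constant
(depending on k) times 4^m such index sequences of length m and (2n)^m walks, while each index
sequence along a given self-avoiding walk has probability k^-m.  For k = 16n the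
union bound decays like 2^-m.

Parameters close to one.  All paths used stay in a plane quadrant and make
unit steps right or up, so they are permitted under both rules.  Inside a thin
cone around the horizontal axis a step to the right increases the l^q norm by
nearly one, hence is increasing unless an endpoint has an exceptional uniform
variable, while a step up never decreases the norm, hence is increasing whenever
the upper uniform variable is the larger one.  Long horizontal blocks yield a
renormalized oriented bond percolation: from a block one can go straight to
the next block, or go to the next block two rows higher, each with probability
close to one.  The block length 2M forces the slope of the cone to be of order
1/M, and about M sites of a row must all be unexceptional; this works because
the defect of the norm increment is o(1/M) ([plane_norm_step]).

Oriented bond percolation is handled without planar topology.  Call a block
blocked when a dual path leads from it to the half plane of negative
[height]; a dual path makes free moves raising the height by one and moves
lowering the height by one that must cross a closed bond.  A boundary between
blocked and unblocked blocks can always be followed one more step through open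
bonds ([frontier_advance]), so if the origin is not blocked there are arbitrarily
long increasing paths.  A self-avoiding dual path from the origin of length N
crosses more than N/2 closed bonds, so the union bound over the 4^N move
sequences shows that the origin is blocked with small probability
([blocked_origin_bound]).

Independence enters only through cylinder events: an event is estimated by
covering it with finitely many cylinders, and such covers multiply over disjoint
sets of sites ([coveredI]). *)

(** * Covering events by cylinders *)

Section CylinderCovers.
Context (d : measure_display) (T : measurableType d) (R : realType).
Context (P : probability T R) (I : eqType) (X : I -> {RV P >-> R}).

Definition cylinder (s : seq I) (A : I -> set R) : set T :=
  [set w | forall i, i \in s -> A i (X i w)].

Definition marginal (i : I) (B : set R) : R := fine (P (X i @^-1` B)).

(** A first-moment certificate: [F] is contained in finitely many cylinders based
on sites of [Q], whose probabilities under independence add up to at most [p].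
Unlike a bound on the probability of [F] alone, this form is stable under
intersection of events based on disjoint sets of sites. *)
Definition covered (Q : set I) (p : R) (F : set T) : Prop :=
  exists (K : finType) (s : K -> seq I) (A : K -> I -> set R),
  [/\ forall k, uniq (s k) /\ (forall i, i \in s k -> Q i),
      forall k i, measurable (A k i),
      F `<=` \bigcup_k cylinder (s k) (A k) &
      \sum_k \prod_(i <- s k) marginal i (A k i) <= p].

Lemma marginal_ge0 i B : 0 <= marginal i B.
Proof. by rewrite /marginal fine_ge0. Qed.

Lemma preimage_measurable i (B : set R) : measurable B -> measurable (X i @^-1` B).
Proof. by move=> mB; rewrite -[_ @^-1` _]setTI; apply: (measurable_funP (X i)). Qed.

Lemma marginalE i (B : set R) : measurable B -> P (X i @^-1` B) = (marginal i B)%:E.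
Proof.
move=> mB; rewrite /marginal fineK // fin_num_measure //.
exact: preimage_measurable.
Qed.

Lemma cylinder_bigI s (A : I -> set R) :
  cylinder s A = \big[setI/setT]_(i <- s) (X i @^-1` A i).
Proof.
elim: s => [|i s IH]; first by rewrite big_nil; apply/seteqP; split.
rewrite big_cons -IH; apply/seteqP; split=> w.
- move=> h; split; first by apply: h; rewrite inE eqxx.
  by move=> j js; apply: h; rewrite inE js orbT.
- by case=> h1 h2 j; rewrite inE => /orP[/eqP->//|]; apply: h2.
Qed.

Lemma measurable_cylinder s (A : I -> set R) :
  (forall i, measurable (A i)) -> measurable (cylinder s A).
Proof.
move=> mA; rewrite cylinder_bigI; apply: bigsetI_measurable => i _.
exact: preimage_measurable.
Qed.

Lemma coveredS Q Q' p p' F F' : Q `<=` Q' -> p <= p' -> F' `<=` F ->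
  covered Q p F -> covered Q' p' F'.
Proof.
move=> sQ lep sF [K [s [A [h1 h2 h3 h4]]]]; exists K, s, A; split=> //.
- by move=> k; have [u h] := h1 k; split=> // i /h /sQ.
- exact: subset_trans h3.
- exact: le_trans lep.
Qed.

Lemma coveredW Q p p' F F' : p <= p' -> F' `<=` F ->
  covered Q p F -> covered Q p' F'.
Proof. exact: coveredS. Qed.

Lemma covered0 Q : covered Q 0 set0.
Proof.
exists void, (fun=> [::]), (fun _ _ => setT); split=> //.
by rewrite big1 // => -[].
Qed.

Lemma coveredT Q : covered Q 1 setT.
Proof.
exists unit, (fun=> [::]), (fun _ _ => setT); split=> //.
- by move=> w _; exists tt.
- by rewrite big_const card_unit /= big_nil addr0.
Qed.

Lemma covered_preimage (Q : set I) i (B : set R) : measurable B -> Q i ->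
  covered Q (marginal i B) (X i @^-1` B).
Proof.
move=> mB Qi; exists unit, (fun=> [:: i]), (fun _ _ => B); split=> //.
- by move=> _; split=> // j; rewrite inE => /eqP->.
- by move=> w Bw; exists tt => // j; rewrite inE => /eqP->.
- by rewrite big_const card_unit /= big_cons big_nil addr0 mulr1.
Qed.

Lemma coveredU Q p1 p2 F1 F2 : covered Q p1 F1 -> covered Q p2 F2 ->
  covered Q (p1 + p2) (F1 `|` F2).
Proof.
move=> [K1 [s1 [A1 [a1 b1 c1 d1]]]] [K2 [s2 [A2 [a2 b2 c2 d2]]]].
exists (K1 + K2)%type,
  (fun k => match k with inl k => s1 k | inr k => s2 k end),
  (fun k => match k with inl k => A1 k | inr k => A2 k end); split.
- by case.
- by case.
- move=> w [/c1[k _ h]|/c2[k _ h]]; [by exists (inl k)|by exists (inr k)].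
- by rewrite big_sumType /= lerD.
Qed.

Lemma covered_bigU (J : eqType) (r : seq J) (Q : set I) (p : J -> R)
    (F : J -> set T) :
  (forall j, j \in r -> covered Q (p j) (F j)) ->
  covered Q (\sum_(j <- r) p j) [set w | exists2 j, j \in r & F j w].
Proof.
elim: r => [|j r IH] h.
  rewrite big_nil; apply: coveredS (covered0 Q) => //.
  by move=> w [].
rewrite big_cons; have h1 := h j (mem_head _ _).
have h2 := IH (fun i ir => h i (mem_behead (s := j :: r) ir)).
apply: coveredS (coveredU h1 h2) => // w [i]; rewrite inE => /orP[/eqP->|ir] Fi.
  by left.
by right; exists i.
Qed.

(** Products of covers: concatenating two cylinders over disjoint sites gives a
cylinder whose weight is the product of the weights, and the double sum
factorizes. *)
Lemma coveredI (Q1 Q2 : set I) p1 p2 F1 F2 :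
  (forall i, Q1 i -> Q2 i -> False) ->
  covered Q1 p1 F1 -> covered Q2 p2 F2 ->
  covered (Q1 `|` Q2) (p1 * p2) (F1 `&` F2).
Proof.
move=> dQ [K1 [s1 [A1 [a1 b1 c1 d1]]]] [K2 [s2 [A2 [a2 b2 c2 d2]]]].
pose A k i := if i \in s1 k.1 then A1 k.1 i else A2 k.2 i.
exists (K1 * K2)%type, (fun k => s1 k.1 ++ s2 k.2), A.
have notin1 k i : i \in s2 k.2 -> (i \in s1 k.1) = false.
  move=> i2; apply/negP => i1.
  by apply: (dQ i); [apply: (a1 k.1).2|apply: (a2 k.2).2].
split.
- move=> k; split.
    rewrite cat_uniq (a1 k.1).1 (a2 k.2).1 andbT /=.
    by apply/hasPn => i /notin1 ->.
  move=> i; rewrite mem_cat => /orP[/(a1 k.1).2|/(a2 k.2).2]; by [left|right].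
- by move=> k i; rewrite /A; case: ifP.
- move=> w [/c1[k1 _ h1] /c2[k2 _ h2]]; exists (k1, k2) => // i /=.
  rewrite mem_cat /A /=; case: ifP => [i1 _|_ /= i2]; [exact: h1|exact: h2].
- have eqA k : \prod_(i <- s1 k.1 ++ s2 k.2) marginal i (A k i) =
    (\prod_(i <- s1 k.1) marginal i (A1 k.1 i)) *
    (\prod_(i <- s2 k.2) marginal i (A2 k.2 i)).
    rewrite big_cat /=; congr (_ * _); apply: eq_big_seq => i hi; rewrite /A.
      by rewrite hi.
    by rewrite notin1.
  under eq_bigr do rewrite eqA.
  rewrite -(pair_bigA _ (fun k1 k2 => (\prod_(i <- s1 k1) marginal i (A1 k1 i)) *
    (\prod_(i <- s2 k2) marginal i (A2 k2 i)))) /=.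
  under eq_bigr do rewrite -mulr_sumr.
  rewrite -mulr_suml; apply: ler_pM => //.
    by apply: sumr_ge0 => k _; apply: prodr_ge0 => i _; apply: marginal_ge0.
  by apply: sumr_ge0 => k _; apply: prodr_ge0 => i _; apply: marginal_ge0.
Qed.

Lemma covered_bigI (J : eqType) (r : seq J) (Q : J -> set I) (p : J -> R)
    (F : J -> set T) :
  uniq r -> (forall j j' i, Q j i -> Q j' i -> j = j') ->
  (forall j, j \in r -> covered (Q j) (p j) (F j)) ->
  covered [set i | exists2 j, j \in r & Q j i] (\prod_(j <- r) p j)
    [set w | forall j, j \in r -> F j w].
Proof.
move=> ur dQ; elim: r ur => [|j r IH] /= ur h.
  by rewrite big_nil; apply: coveredS (coveredT set0).
case/andP: ur => jr ur; rewrite big_cons.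
have h1 := h j (mem_head _ _).
have h2 := IH ur (fun i ir => h i (mem_behead (s := j :: r) ir)).
apply: coveredS (coveredI _ h1 h2) => //.
- move=> i [Qi|[j' j'r Qi]]; first by exists j; rewrite ?mem_head.
  by exists j' => //; rewrite inE j'r orbT.
- move=> w hw; split; first by apply: hw; rewrite mem_head.
  by move=> j' j'r; apply: hw; rewrite inE j'r orbT.
- move=> i Qi [j' j'r Q'i]; have e := dQ _ _ _ Qi Q'i.
  by rewrite e j'r in jr.
Qed.

(** The place where independence is used: the weight of a cylinder is its
probability, and the union bound applies.  A measurable superset is produced
because [F] may fail to be measurable. *)
Lemma covered_bound (indX : mutually_independent X) Q p F :
  covered Q p F -> exists G, [/\ measurable G, F `<=` G & (P G <= p%:E)%E].
Proof.
move=> [K [s [A [a b c e]]]].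
have mC k : measurable (cylinder (s k) (A k)) by exact: measurable_cylinder.
have inU (r : seq K) k w : k \in r -> cylinder (s k) (A k) w ->
    (\big[setU/set0]_(k <- r) cylinder (s k) (A k)) w.
  elim: r => // k' r IH; rewrite inE big_cons => /orP[/eqP<- h|kr h]; first by left.
  by right; apply: IH.
have mU (r : seq K) : measurable (\big[setU/set0]_(k <- r) cylinder (s k) (A k)).
  by apply: bigsetU_measurable => k _.
exists (\big[setU/set0]_k cylinder (s k) (A k)); split=> //.
  by move=> w /c[k _ h]; apply: (inU _ k); rewrite ?mem_index_enum.
have bound (r : seq K) : (P (\big[setU/set0]_(k <- r) cylinder (s k) (A k)) <=
    (\sum_(k <- r) \prod_(i <- s k) marginal i (A k i))%:E)%E.
  elim: r => [|k r IH]; first by rewrite !big_nil measure0.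
  have Pk : P (cylinder (s k) (A k)) = (\prod_(i <- s k) marginal i (A k i))%:E.
    rewrite cylinder_bigI (indX _ _ (a k).1 (b k)) -prodEFin.
    by apply: eq_bigr => i _; exact: marginalE.
  by rewrite !big_cons EFinD -Pk; apply: le_trans (measureU2 _ _ _) (leeD _ _).
by apply: le_trans (bound _) _; rewrite lee_fin.
Qed.

End CylinderCovers.

(** * Uniform marginals *)

Section UniformMarginals.
Context (d : measure_display) (T : measurableType d) (R : realType).
Context (P : probability T R) (I : eqType) (U : I -> {RV P >-> R}).

Lemma uniform_prob_le (A : set R) (s t : R) : measurable A -> s <= t ->
  A `&` `[0, 1] `<=` `[s, t] -> (uniform_prob (@ltr01 R) A <= (t - s)%:E)%E.
Proof.
move=> mA st sA; rewrite /uniform_prob integral_uniform_pdf.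
have mA01 : measurable (A `&` `[0, 1] : set R) by exact: measurableI.
rewrite (eq_integral (cst 1%E)); last first.
  move=> x; rewrite inE => -[_]; rewrite /= in_itv /= /uniform_pdf => ->.
  by rewrite subr0 invr1.
rewrite integral_cst // mul1e.
have := @le_measure _ _ _ (@lebesgue_measure R) (A `&` `[0, 1]%classic) `[s, t]%classic.
rewrite !inE => /(_ mA01 (measurable_itv _) sA) /le_trans; apply.
have le_st : (lebesgue_measure (`[s, t]%classic : set R) <= (t - s)%:E)%E.
  by rewrite lebesgue_measure_itv /= lte_fin; case: ltP => // _; rewrite lee_fin subr_ge0.
exact: le_st.
Qed.

Lemma marginal_uniform_le (hU : iid_uniform01 U) i (A : set R) (s t : R) :
  measurable A -> s <= t -> A `&` `[0, 1] `<=` `[s, t] ->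
  marginal U i A <= t - s.
Proof.
move=> mA st sA; rewrite -lee_fin -marginalE //.
by have := hU.2 i A mA; rewrite /distribution /pushforward => ->; exact: uniform_prob_le.
Qed.

End UniformMarginals.

(** * The l^q norm and its increments along lattice steps *)

Section LqNorm.
Context (R : realType) (n : nat).
Implicit Types (x y : 'I_n -> R) (q : \bar R).

(** The formula of [lq_norm] on real vectors, which allows the rescalings needed
for the triangle inequality and for convexity arguments. *)
Definition rnorm q x : R :=
  match q with
  | r%:E => (\sum_(i < n) (`|x i| `^ r)) `^ r^-1
  | +oo%E => \big[Num.max/0]_(i < n) `|x i|
  | -oo%E => 0
  end.

Lemma exponent_cases (q : \bar R) : (1 <= q)%E ->
  (exists2 r : R, 1 <= r & q = r%:E) \/ q = +oo%E.
Proof.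
case: q => [r|_|]; last by rewrite leeNy_eq.
  by rewrite lee_fin => r1; left; exists r.
by right.
Qed.

Lemma rnorm_fin (r : R) x : rnorm r%:E x = (\sum_(i < n) (`|x i| `^ r)) `^ r^-1.
Proof. by []. Qed.

Lemma rnorm_pinfty x : rnorm +oo%E x = \big[Num.max/0]_(i < n) `|x i|.
Proof. by []. Qed.

Lemma lq_normE q (v : 'rV[int]_n) : lq_norm q v = rnorm q (fun i => (v 0 i)%:~R).
Proof.
case: q => [r| |]; rewrite /lq_norm /rnorm.
- by congr (_ `^ _); apply: eq_bigr => i _; rewrite intr_norm.
- by apply: eq_bigr => i _; rewrite intr_norm.
- exact: erefl.
Qed.

Lemma rnorm_ge0 q x : 0 <= rnorm q x.
Proof.
case: q => [r| |]; rewrite /rnorm; [exact: powR_ge0| |exact: lexx].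
by elim/big_ind : _ => // a b a0 b0; rewrite le_max a0.
Qed.

Lemma sum_powR_ge0 (r : R) x : 0 <= \sum_(i < n) `|x i| `^ r.
Proof. by apply: sumr_ge0 => i _; exact: powR_ge0. Qed.

Lemma rnorm_powR (r : R) x : 1 <= r ->
  rnorm r%:E x `^ r = \sum_(i < n) `|x i| `^ r.
Proof.
move=> r1; rewrite /= -powRrM mulVf ?powRr1 ?sum_powR_ge0 //.
by rewrite gt_eqF // (lt_le_trans ltr01).
Qed.

Lemma rnorm_le_powR (r : R) x c : 1 <= r -> 0 <= c ->
  \sum_(i < n) `|x i| `^ r <= c `^ r -> rnorm r%:E x <= c.
Proof.
move=> r1 c0 h; have r0 : 0 < r by exact: lt_le_trans r1.
have -> : c = (c `^ r) `^ r^-1 by rewrite -powRrM mulfV ?powRr1 ?gt_eqF.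
apply: ge0_ler_powR => //; rewrite ?nnegrE ?powR_ge0 ?sum_powR_ge0 //.
by rewrite invr_ge0 ltW.
Qed.

Lemma rnorm_mono q x y : (1 <= q)%E -> (forall i, `|x i| <= `|y i|) ->
  rnorm q x <= rnorm q y.
Proof.
move=> /exponent_cases[[r r1 ->]|->].
- move=> xy; apply: rnorm_le_powR (rnorm_ge0 r%:E _) _ => //.
  rewrite rnorm_powR //; apply: ler_sum => i _.
  by apply: ge0_ler_powR; rewrite ?nnegrE // (le_trans ler01).
- rewrite !rnorm_pinfty => xy; elim/big_ind2 : _ => // a b c e ab ce.
  by rewrite ge_max !le_max ab ce orbT.
Qed.

Lemma coord_le_rnorm q x i : (1 <= q)%E -> `|x i| <= rnorm q x.
Proof.
move=> /exponent_cases[[r r1 ->]|->].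
- have r0 : 0 < r by exact: lt_le_trans r1.
  rewrite rnorm_fin -[leLHS]powRr1 // -(mulfV (lt0r_neq0 r0)) powRrM.
  apply: ge0_ler_powR; rewrite ?nnegrE ?powR_ge0 ?sum_powR_ge0 ?invr_ge0 ?(ltW r0) //.
  by rewrite (bigD1 i) //= lerDl; apply: sumr_ge0 => j _; exact: powR_ge0.
- by rewrite rnorm_pinfty; exact: (le_bigmax _ (fun i => `|x i|)).
Qed.

Lemma rnormZ q c x : (1 <= q)%E -> 0 <= c ->
  rnorm q (fun i => c * x i) = c * rnorm q x.
Proof.
move=> /exponent_cases[[r r1 ->]|->].
- move=> c0; rewrite !rnorm_fin; have r0 : 0 < r by exact: lt_le_trans r1.
  under eq_bigr do rewrite normrM (ger0_norm c0) powRM //.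
  rewrite -mulr_sumr powRM ?powR_ge0 ?sum_powR_ge0 // -powRrM mulfV ?gt_eqF //.
  by rewrite powRr1.
- move=> c0; rewrite !rnorm_pinfty (big_morph (fun z => c * z) (id1 := 0) (op1 := Num.max)).
  + by apply: eq_bigr => i _; rewrite normrM ger0_norm.
  + by move=> a b; rewrite maxr_pMr.
  + by rewrite mulr0.
Qed.

Lemma powR_convex_comb (r a b u v : R) : 1 <= r -> 0 <= a -> 0 <= b ->
  0 <= u -> 0 <= v -> u + v = 1 ->
  (u * a + v * b) `^ r <= u * a `^ r + v * b `^ r.
Proof.
move=> r1 a0 b0 u0 v0 uv.
have u1 : u <= 1 by lra.
have := @convex_powR R r r1 (Itv01 u0 u1) a b.
rewrite !inE /= !in_itv /= !andbT => /(_ a0 b0).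
have -> : v = 1 - u by lra.
exact: id.
Qed.

(** The coordinatewise inequality behind Minkowski's inequality: [(a + b) / (s + t)]
is the convex combination of [a / s] and [b / t] with weights [s / (s + t)] and
[t / (s + t)].  With [s] and [t] the norms of two vectors, summing over the
coordinates gives the triangle inequality. *)
Lemma powR_rescaled_convex (r s t a b : R) : 1 <= r -> 0 < s -> 0 < t ->
  0 <= a -> 0 <= b ->
  (a + b) `^ r <= (s + t) `^ r * (s / (s + t) * (a `^ r / s `^ r) +
                                  t / (s + t) * (b `^ r / t `^ r)).
Proof.
move=> r1 s0 t0 a0 b0; have st0 : 0 < s + t by rewrite addr_gt0.
have divpow c z : 0 < c -> 0 <= z -> z `^ r / c `^ r = (z / c) `^ r.
  move=> c0 z0.
  by rewrite powRM ?invr_ge0 ?(ltW c0) // -(powR_inv1 (ltW c0)) powRAC powR_inv1 ?powR_ge0.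
rewrite !divpow //.
have -> : a + b = (s + t) * (s / (s + t) * (a / s) + t / (s + t) * (b / t)).
  by field; rewrite !gt_eqF.
rewrite powRM ?(ltW st0) //; last first.
  by rewrite addr_ge0 // !mulr_ge0 ?invr_ge0 ?(ltW s0) ?(ltW t0) ?(ltW st0).
apply: ler_wpM2l; first exact: powR_ge0.
apply: powR_convex_comb; rewrite ?divr_ge0 ?(ltW s0) ?(ltW t0) ?(ltW st0) //.
by rewrite -mulrDl divff // gt_eqF.
Qed.

Lemma ler_rnormD q x y : (1 <= q)%E ->
  rnorm q (fun i => x i + y i) <= rnorm q x + rnorm q y.
Proof.
move=> q1.
have [x0|x0] := eqVneq (rnorm q x) 0.
  have xi0 i : x i = 0.
    by apply/normr0_eq0/eqP; rewrite eq_le normr_ge0 -x0 coord_le_rnorm.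
  rewrite x0 add0r; apply: rnorm_mono => // i.
  by rewrite xi0 add0r.
have [y0|y0] := eqVneq (rnorm q y) 0.
  have yi0 i : y i = 0.
    by apply/normr0_eq0/eqP; rewrite eq_le normr_ge0 -y0 coord_le_rnorm.
  rewrite y0 addr0; apply: rnorm_mono => // i.
  by rewrite yi0 addr0.
have {x0} s0 : 0 < rnorm q x by rewrite lt_def x0 rnorm_ge0.
have {y0} t0 : 0 < rnorm q y by rewrite lt_def y0 rnorm_ge0.
have [[r r1 qE]|qE] := exponent_cases q1; rewrite qE in q1 s0 t0 *; last first.
  rewrite [leLHS]rnorm_pinfty; apply/bigmax_leP; split.
    by rewrite addr_ge0 // (rnorm_ge0 +oo%E).
  move=> i _; apply: le_trans (ler_normD _ _) _; apply: lerD.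
    exact: (coord_le_rnorm (q := +oo%E)).
  exact: (coord_le_rnorm (q := +oo%E)).
have sE := rnorm_powR x r1; have tE := rnorm_powR y r1.
move: (rnorm _ x) (rnorm _ y) s0 t0 sE tE => s t s0 t0 sE tE.
have st0 : 0 < s + t by lra.
apply: rnorm_le_powR => //; first exact: ltW.
have step i : `|x i + y i| `^ r <=
    (s + t) `^ r * (s / (s + t) * (`|x i| `^ r / s `^ r) +
                    t / (s + t) * (`|y i| `^ r / t `^ r)).
  apply: le_trans (powR_rescaled_convex r1 s0 t0 (normr_ge0 _) (normr_ge0 _)).
  apply: ge0_ler_powR; rewrite ?nnegrE ?addr_ge0 ?ler_normD //.
  by rewrite (le_trans ler01).
apply: le_trans (ler_sum _ (fun i _ => step i)) _.
rewrite -mulr_sumr big_split /= -!mulr_sumr -!mulr_suml -sE -tE.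
rewrite !divff ?gt_eqF ?powR_gt0 // !mulr1 -mulrDl divff ?gt_eqF //.
by rewrite mulr1.
Qed.

Lemma rnorm_unit q i : (1 <= q)%E -> rnorm q (fun j => (j == i)%:R) = 1.
Proof.
move=> q1; apply/eqP; rewrite eq_le; apply/andP; split; last first.
  by have := coord_le_rnorm (fun j => (j == i)%:R) i q1; rewrite eqxx normr1.
have [[r r1 ->]|->] := exponent_cases q1.
- apply: (rnorm_le_powR r1 ler01).
  rewrite powR1 (bigD1 i) //= eqxx normr1 powR1 big1 ?addr0 // => j /negbTE ->.
  by rewrite normr0 powR0 // gt_eqF // (lt_le_trans ltr01).
- by rewrite rnorm_pinfty; apply/bigmax_leP; split=> // j _; case: eqP; rewrite ?normr1 ?normr0.
Qed.

End LqNorm.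

Section PlaneIncrements.
Context (R : realType) (n : nat) (hn : (2 <= n)%N).
Implicit Types (q : \bar R) (a b : R).

(** Polymorphic so that integer points and real vectors of the plane spanned by the
first two coordinates share one definition. *)
Definition plane_vec (A : nmodType) (a b : A) (i : 'I_n) : A :=
  if val i == 0%N then a else if val i == 1%N then b else 0.

Let i0 : 'I_n := Ordinal (ltn_trans (ltnSn 0) hn).
Let i1 : 'I_n := Ordinal hn.

Lemma sum_plane_powR (r a b : R) : r != 0 ->
  \sum_(i < n) `|plane_vec a b i| `^ r = `|a| `^ r + `|b| `^ r.
Proof.
move=> r0; rewrite (bigD1 i0) //= (bigD1 i1) //= /plane_vec /=.
rewrite big1 ?addr0 // => i /andP[ni0 ni1].
rewrite -!(inj_eq val_inj) /= in ni0 ni1.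
by rewrite (negbTE ni0) (negbTE ni1) normr0 powR0.
Qed.

Lemma le_plane_norm q a b : (1 <= q)%E -> 0 <= a -> a <= rnorm q (plane_vec a b).
Proof.
move=> q1 a0; have := coord_le_rnorm (plane_vec a b) i0 q1.
by rewrite {1}/plane_vec /= ger0_norm.
Qed.

Lemma plane_norm_mono q a b a' b' : (1 <= q)%E -> 0 <= a <= a' -> 0 <= b <= b' ->
  rnorm q (plane_vec a b) <= rnorm q (plane_vec a' b').
Proof.
move=> q1 /andP[a0 aa] /andP[b0 bb]; apply: rnorm_mono => // i.
have a'0 := le_trans a0 aa; have b'0 := le_trans b0 bb.
by rewrite /plane_vec; case: eqP => _; [|case: eqP => _]; rewrite ?ger0_norm.
Qed.

(** In the cone [M * b <= a] the norm is nearly linear in [a] with slope one, and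
the relative error [gamma / M] is of smaller order than the opening [1 / M]
of the cone.  For q = 1 and q = +oo there is no error at all; for the other
exponents the error is of order [M^-r], and [r > 1]. *)
Lemma plane_norm_halving q (gamma : R) : (1 <= q)%E -> 0 < gamma ->
  exists M0 : nat, forall M : nat, (M0 < M)%N -> forall a b : R,
    0 < a -> 0 <= b -> M%:R * b <= a ->
    a / 2 * (1 - gamma / M%:R) <=
    rnorm q (plane_vec a b) - rnorm q (plane_vec (a / 2) b).
Proof.
move=> q1 g0; have [[r r1 qE]|qE] := exponent_cases q1; rewrite {}qE in q1 *; last first.
  exists 1%N => M M1 a b a0 b0 Mba.
  have b2 : b <= a / 2.
    have : 2%:R * b <= M%:R * b by apply: ler_wpM2r => //; rewrite ler_nat.
    by move: Mba; set z := M%:R * b; lra.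
  have h1 : rnorm +oo%E (plane_vec (a / 2) b) <= a / 2.
    rewrite rnorm_pinfty; apply/bigmax_leP; split=> [|i _]; first by lra.
    have a20 : 0 <= a / 2 by lra.
    by rewrite /plane_vec; case: eqP => _; [|case: eqP => _]; rewrite ?ger0_norm ?normr0.
  have h2 := le_plane_norm b q1 (ltW a0).
  have gM : 0 <= gamma / M%:R by rewrite divr_ge0 // ltW.
  have : 0 <= a * (gamma / M%:R) by rewrite mulr_ge0 // ltW.
  by set z := gamma / _; set z1 := rnorm _ _ in h1 *; set z2 := rnorm _ _ in h2 *; nra.
have r0 : 0 < r by exact: lt_le_trans r1.
have [re|rn1] := eqVneq r 1.
  exists 1%N => M M1 a b a0 b0 Mba.
  have NE z : 0 <= z -> rnorm r%:E (plane_vec z b) = z + b.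
    move=> z0; rewrite rnorm_fin re invr1 sum_plane_powR ?oner_eq0 //.
    by rewrite !powRr1 ?addr_ge0 ?powR_ge0 // !ger0_norm.
  rewrite !NE ?(ltW a0) ?divr_ge0 ?(ltW a0) //.
  have gM : 0 <= gamma / M%:R by rewrite divr_ge0 // ltW.
  by set z := gamma / _ in gM *; nra.
have {rn1} r1' : 0 < r - 1 by rewrite subr_gt0 lt_def rn1.
(* [c] is chosen so that [c `^ (r - 1) = gamma / 2]. *)
pose c := (gamma / 2) `^ (r - 1)^-1.
have c0 : 0 < c by rewrite powR_gt0 // divr_gt0.
exists (Num.truncn (2 / c)) => M M1 a b a0 b0 Mba.
have M0 : 0 < M%:R :> R by rewrite ltr0n (leq_trans _ M1).
have Mc : 2 / M%:R <= c.
  have : 2 / c <= M%:R.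
    apply: ltW; apply: lt_le_trans (truncnS_gt _) _; by rewrite ler_nat.
  by rewrite ler_pdivrMr // ler_pdivrMr // mulrC.
have small : (2 / M%:R) `^ r <= gamma / M%:R.
  have -> : r = 1 + (r - 1) by ring.
  rewrite powRD; last by rewrite addrC subrK gt_eqF.
  rewrite powRr1 ?divr_ge0 //.
  have : (2 / M%:R) `^ (r - 1) <= gamma / 2.
    have -> : gamma / 2 = c `^ (r - 1).
      rewrite /c -powRrM mulVf ?gt_eqF // powRr1 // divr_ge0 // ltW //.
    apply: ge0_ler_powR => //; rewrite ?nnegrE ?(ltW r1') ?(ltW c0) ?divr_ge0 //.
  have -> : gamma / M%:R = 2 / M%:R * (gamma / 2) by field; rewrite gt_eqF.
  by move=> h; apply: ler_wpM2l => //; apply: divr_ge0 => //; apply: ltW.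
have a20 : 0 < a / 2 by rewrite divr_gt0.
have h1 : rnorm r%:E (plane_vec (a / 2) b) <= a / 2 * (1 + gamma / M%:R).
  have g1 : 1 <= 1 + gamma / M%:R by rewrite lerDl divr_ge0 // ltW.
  apply: rnorm_le_powR => //; first by rewrite mulr_ge0 // ?(ltW a20) // (le_trans ler01).
  rewrite sum_plane_powR ?gt_eqF // (ger0_norm b0) (ger0_norm (ltW a20)).
  rewrite [leRHS]powRM ?(ltW a20) ?(le_trans ler01) //.
  apply: (@le_trans _ _ ((a / 2) `^ r * (1 + gamma / M%:R))); last first.
    by apply: ler_wpM2l; [exact: powR_ge0|exact: le1r_powR].
  rewrite mulrDr mulr1 lerD2l.
  apply: (@le_trans _ _ ((a / 2) `^ r * (2 / M%:R) `^ r)); last first.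
    by apply: ler_wpM2l => //; exact: powR_ge0.
  have M2 : 0 <= 2 / M%:R :> R by exact: divr_ge0 (ltW M0).
  rewrite -powRM ?(ltW a20) //.
  apply: ge0_ler_powR; rewrite ?nnegrE ?(ltW r0) ?mulr_ge0 ?(ltW a0) //.
  have -> : a / 2 * (2 / M%:R) = a / M%:R by field; rewrite gt_eqF.
  by rewrite ler_pdivlMr // mulrC.
have h2 := le_plane_norm b q1 (ltW a0).
by move: h1 h2; set z := gamma / _; set z1 := rnorm _ _; set z2 := rnorm _ _; nra.
Qed.

(** By convexity of the norm in its first coordinate, the increment from
[a] to [a + 1] is at least the average slope between [a / 2] and [a], which
[plane_norm_halving] controls. *)
Lemma plane_norm_step q (gamma : R) : (1 <= q)%E -> 0 < gamma ->
  exists M0 : nat, forall M : nat, (M0 < M)%N -> forall a b : R,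
    0 < a -> 0 <= b -> M%:R * b <= a ->
    rnorm q (plane_vec a b) + (1 - gamma / M%:R) <= rnorm q (plane_vec (a + 1) b).
Proof.
move=> q1 g0; have [M0 hM] := plane_norm_halving q1 g0.
exists M0 => M MM a b a0 b0 Mba; have := hM M MM a b a0 b0 Mba.
have a2 : 0 <= a / 2 by rewrite divr_ge0 // ltW.
(* [(a / 2 + 1) (a, b) = (a / 2) (a + 1, b) + (a / 2, b)] *)
have : rnorm q (fun i => a / 2 * plane_vec (a + 1) b i + plane_vec (a / 2) b i)
    = (a / 2 + 1) * rnorm q (plane_vec a b).
  rewrite -rnormZ ?addr_ge0 //; congr (rnorm q _); apply: funext => i.
  by rewrite /plane_vec; case: eqP => _; [|case: eqP => _]; field.
have := ler_rnormD (fun i => a / 2 * plane_vec (a + 1) b i) (plane_vec (a / 2) b) q1.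
rewrite rnormZ // => h e; rewrite e in h; move: h.
set u := rnorm _ _; set v := rnorm _ _; set w := rnorm _ _; set z := gamma / _.
move=> h1 h2.
have a20 : 0 < a / 2 by rewrite divr_gt0.
by rewrite -(ler_pM2l a20); nra.
Qed.

End PlaneIncrements.

Section LatticeSteps.
Context (n : nat).

Lemma lq_dist0 (R : realType) (q : \bar R) (v : 'rV[int]_n) : (1 <= q)%E ->
  lq_dist q 0 v = rnorm q (fun i => (v 0 i)%:~R).
Proof.
move=> q1; rewrite /lq_dist sub0r lq_normE; apply/eqP.
by rewrite eq_le !rnorm_mono // => i; rewrite !mxE rmorphN normrN.
Qed.

Lemma adjacent_delta (u v : 'rV[int]_n) : Defs.adjacent u v ->
  exists i : 'I_n, exists s : bool, v = u + (-1) ^+ s *: delta_mx 0 i.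
Proof.
have [z zvu] : exists z, z = v - u by eexists.
rewrite /Defs.adjacent -zvu => h.
have [i zi] : exists i : 'I_n, `|z 0%R i|%N != 0%N.
  apply/existsP; apply: contra_eqT h => /existsPn h; rewrite /l1norm big1 // => i _.
  by apply/eqP; move: (h i); rewrite negbK.
exists i, (z 0 i < 0).
have hi : (`|z 0%R i|%N + \sum_(j < n | j != i) `|z 0%R j|%N = 1)%N.
  by move: h; rewrite /l1norm (bigD1 i).
have zi1 : (`|z 0%R i| = 1)%N by lia.
have /eqP : (\sum_(j < n | j != i) `|z 0%R j|%N = 0)%N by lia.
rewrite sum_nat_eq0 => /forallP hj.
have zE : z = (-1) ^+ (z 0 i < 0)%R *: delta_mx 0 i.
  apply/rowP => j; rewrite !mxE eqxx /=; have [->|ji] := eqVneq j i.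
    by case: (ltP (z 0 i) 0) => /= z0; rewrite ?expr0 ?expr1 ?mulr1; move: (z 0 i) zi1 z0 => k; clear; lia.
  by have := hj j; rewrite ji /= mulr0 => /eqP; lia.
by rewrite -zE zvu addrC subrK.
Qed.

Lemma lq_dist_adjacent (R : realType) (q : \bar R) (u v : 'rV[int]_n) :
  (1 <= q)%E -> Defs.adjacent u v -> lq_dist q 0 v <= lq_dist q 0 u + 1.
Proof.
move=> q1 /adjacent_delta[i [s ->]]; rewrite !lq_dist0 //.
apply: (@le_trans _ _ (rnorm q (fun j => `|(u 0 j)%:~R| : R) +
    rnorm q (fun j => (j == i)%:R : R))); last first.
  by rewrite rnorm_unit // lerD2r; apply: rnorm_mono => // j; rewrite normr_id.
apply: le_trans (ler_rnormD _ _ q1); apply: rnorm_mono => // j.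
rewrite !mxE eqxx /= rmorphD rmorphM rmorphXn rmorphN1 /=.
rewrite [leRHS]ger0_norm ?addr_ge0 //.
apply: le_trans (ler_normD _ _) _; rewrite lerD2l.
by rewrite normrM normrX normrN1 expr1n mul1r; case: eqP; rewrite ?normr1 ?normr0.
Qed.

End LatticeSteps.

(** * Accessible paths and measurability of the percolation event *)

Section Accessibility.
Context (R : realType) (n : nat) (c : path_rule).
Local Notation V := 'rV[int]_n.
Implicit Types (f : V -> R) (u v : V).

(** Injectivity of a path is not part of a step: it follows from the increase of
[f]. *)
Definition up_step f u v : Prop :=
  [/\ Defs.adjacent u v,
      match c with
      | NonBacktracking => (l1norm u < l1norm v)%N
      | AllSimple => True
      end & f u < f v].

Fixpoint climbs f (m : nat) u : Prop :=
  if m is m'.+1 then exists2 v, up_step f u v & climbs f m' v else True.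

Definition neighbours u : seq V :=
  [seq u + (-1) ^+ p.2 *: delta_mx 0 p.1 | p : ('I_n * bool)%type].

Lemma size_neighbours u : size (neighbours u) = (2 * n)%N.
Proof. by rewrite size_map -cardE card_prod card_ord card_bool mulnC. Qed.

Lemma up_step_neighbours f u v : up_step f u v -> v \in neighbours u.
Proof.
case=> /adjacent_delta[i [s ->]] _ _.
by apply: (map_f (fun p : 'I_n * bool => u + (-1) ^+ p.2 *: delta_mx 0 p.1) (x := (i, s))); rewrite mem_enum.
Qed.

Lemma climbsW f m u : climbs f m.+1 u -> climbs f m u.
Proof. by elim: m u => //= m IH u [v uv h]; exists v => //; exact: IH. Qed.

Lemma climbs_le f m m' u : (m <= m')%N -> climbs f m' u -> climbs f m u.
Proof.
move=> /subnK <-; elim: (m' - m)%N => // k IH h.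
by apply: IH; apply: climbsW.
Qed.

(** The pigeonhole step of Koenig's lemma: if no neighbour could be continued
forever, the maximum of the finitely many failing lengths would contradict the
hypothesis. *)
Lemma climbs_forever_step f u : (forall m, climbs f m u) ->
  exists2 v, up_step f u v & forall m, climbs f m v.
Proof.
move=> hu; pose Q m v := up_step f u v /\ climbs f m v.
suff [v _ hv] : exists2 v, v \in neighbours u & forall m, Q m v.
  by exists v => [|m]; [exact: (hv 0%N).1|exact: (hv m).2].
have QW m m' v : (m <= m')%N -> Q m' v -> Q m v.
  by move=> mm [h1 h2]; split=> //; apply: climbs_le h2.
have : forall m, exists2 v, v \in neighbours u & Q m v.
  move=> m; have [v uv hv] := hu m.+1.
  by exists v => //; exact: up_step_neighbours uv.
elim: (neighbours u) => [/(_ 0%N)[]//|v r IH h].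
have [hv|/existsNP[m0 hm0]] := pselect (forall m, Q m v).
  by exists v => //; rewrite mem_head.
have [|v' v'r hv'] := IH.
  move=> m; have [v' + hv'] := h (maxn m m0).
  rewrite inE => /orP[/eqP ev|v'r]; last first.
    by exists v' => //; apply: QW hv'; exact: leq_maxl.
  by case: hm0; rewrite -ev; apply: QW hv'; exact: leq_maxr.
by exists v' => //; rewrite inE v'r orbT.
Qed.

Lemma climbs_forever_path f : (forall m, climbs f m 0) ->
  exists2 x : nat -> V, permitted c x & forall j, f (x j) < f (x j.+1).
Proof.
move=> h0.
have [g hg] : {g : V -> V & forall u, (forall m, climbs f m u) ->
    up_step f u (g u) /\ (forall m, climbs f m (g u))}.
  apply: (@choice _ _ (fun u v => (forall m, climbs f m u) ->
    up_step f u v /\ (forall m, climbs f m v))) => u.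
  have [/climbs_forever_step[v uv hv]|nh] := pselect (forall m, climbs f m u).
    by exists v.
  by exists u.
have hx j : forall m, climbs f m (iter j g 0).
  by elim: j => [|j IH] //=; exact: (hg _ IH).2.
have sx j : up_step f (iter j g 0) (iter j.+1 g 0) by exact: (hg _ (hx j)).1.
have fx j : f (iter j g 0) < f (iter j.+1 g 0) by case: (sx j).
exists (fun j => iter j g 0) => //; split=> //.
- by move=> j; case: (sx j).
- have fmono : {homo (fun j => f (iter j g 0)) : i j / (i < j)%N >-> i < j}.
    by apply: homo_ltn => [y x z|//]; exact: lt_trans.
  move=> i j /= eij; case: (ltngtP i j) => // /fmono /=; by rewrite eij ltxx.
- by move: sx; rewrite /up_step; case: (c) => // sx j; case: (sx j).
Qed.

Lemma path_climbs f (x : nat -> V) : permitted c x ->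
  (forall j, f (x j) < f (x j.+1)) -> forall m, climbs f m 0.
Proof.
case=> x0 ax _ cx fx m; rewrite -x0; move: 0%N.
elim: m => //= m IH j; exists (x j.+1) => //; split=> //.
by move: cx; case: (c) => // cx; exact: cx.
Qed.

Fixpoint walks (m : nat) u : seq (seq V) :=
  if m is m'.+1 then [seq u :: p | v <- neighbours u, p <- walks m' v]
  else [:: [:: u]].

Lemma sum_walks (a : R) m u :
  \sum_(p <- walks m u) a = (2 * n)%:R ^+ m * a.
Proof.
elim: m u => [|m IH] u; first by rewrite /= big_seq1 expr0 mul1r.
rewrite /= big_allpairs_dep /=; under eq_bigr do rewrite IH.
by rewrite big_const_seq count_predT size_neighbours iter_addr_0 exprS -mulrA mulr_natl.
Qed.

Lemma size_walks m u p : p \in walks m u -> size p = m.+1.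
Proof.
elim: m u p => [|m IH] u p /=; first by rewrite inE => /eqP->.
by case/allpairsPdep=> v [p' [_ /IH sp ->]] /=; rewrite sp.
Qed.

Lemma climbs_walk f m u : climbs f m u ->
  exists2 p, u :: p \in walks m u & path (fun x y => `[< up_step f x y >]) u p.
Proof.
elim: m u => [|m IH] u /=; first by move=> _; exists [::]; rewrite ?mem_head.
move=> [v uv /IH[p pw pp]]; exists (v :: p).
  by apply/allpairsPdep; exists v, (v :: p); split=> //; exact: up_step_neighbours uv.
by rewrite /= pp andbT; apply/asboolP.
Qed.

End Accessibility.

Section PercolationEvent.
Context (d : measure_display) (T : measurableType d) (R : realType).
Context (P : probability T R) (n : nat) (U : 'rV[int]_n -> {RV P >-> R}).
Variables (q : \bar R) (c : path_rule).

(** Koenig's lemma turns the uncountable union over infinite paths into a countable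
intersection of events that depend on finitely many sites. *)
Lemma percolationE theta : rmf_percolation U q c theta =
  \bigcap_m [set w | climbs c (fun v => rmf_label U q theta v w) m 0].
Proof.
apply/seteqP; split=> w.
- by move=> [x px fx] m _; exact: path_climbs px fx m.
- by move=> h; have [x px fx] := climbs_forever_path (fun m => h m I); exists x.
Qed.

Lemma measurable_climbs theta m u :
  measurable [set w | climbs c (fun v => rmf_label U q theta v w) m u].
Proof.
elim: m u => [|m IH] u /=; first by rewrite [X in measurable X](_ : _ = setT) //; apply/seteqP.
have -> : [set w | exists2 v, up_step c (fun v => rmf_label U q theta v w) u v &
     climbs c (fun v => rmf_label U q theta v w) m v] =
  \bigcup_v ([set w | up_step c (fun v => rmf_label U q theta v w) u v] `&`
     [set w | climbs c (fun v => rmf_label U q theta v w) m v]).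
  by apply/seteqP; split=> w [v]; [exists v|move=> _ []; exists v].
apply: countable_bigcupT_measurable; first exact: countableP.
move=> v; apply: measurableI; last exact: IH.
have mlab x : measurable_fun setT (rmf_label U q theta x).
  by apply: measurable_funD => //; exact: measurable_funP.
have mlt : measurable [set w | rmf_label U q theta u w < rmf_label U q theta v w].
  rewrite -[X in measurable X]setTI.
  exact: (measurable_fun_ltr (mlab u) (mlab v) measurableT (Y := [set true])).
have [auv|auv] := pselect (Defs.adjacent u v); last first.
  by rewrite [X in measurable X](_ : _ = set0) //; apply/seteqP; split=> w // [].
have [cuv|cuv] := pselect match c with
      | NonBacktracking => (l1norm u < l1norm v)%N : Prop
      | AllSimple => True
      end.
  rewrite [X in measurable X](_ : _ = [set w | rmf_label U q theta u w < rmf_label U q theta v w]) //.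
  by apply/seteqP; split=> w //= [].
by rewrite [X in measurable X](_ : _ = set0) //; apply/seteqP; split=> w // [].
Qed.

Lemma measurable_percolation theta : measurable (rmf_percolation U q c theta).
Proof.
rewrite percolationE; apply: bigcapT_measurable => m.
exact: measurable_climbs.
Qed.

End PercolationEvent.

(** * No percolation for small parameters *)

Section Subcritical.
Context (d : measure_display) (T : measurableType d) (R : realType).
Context (P : probability T R) (n : nat) (U : 'rV[int]_n -> {RV P >-> R}).
Variables (q : \bar R) (c : path_rule).
Hypotheses (q1 : (1 <= q)%E) (hU : iid_uniform01 U).
Variable k : nat.
Hypothesis k0 : (0 < k)%N.

(** The half-open interval from [a / k] to [(a + 1) / k], except that the first and last cells are
extended to infinity: the cells then cover the whole line, so no null set of
values outside the unit interval has to be discarded. *)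
Definition cell (a : nat) : set R :=
  (if a == 0%N then setT else `[a%:R / k%:R, +oo[%classic) `&`
  (if a.+1 == k then setT else `]-oo, a.+1%:R / k%:R[%classic).

Lemma measurable_cell a : measurable (cell a).
Proof.
rewrite /cell; case: eqP => _; case: eqP => _; rewrite ?setTI ?setIT //.
by apply: measurableI.
Qed.

Let kR0 : 0 < k%:R :> R. Proof. by rewrite ltr0n. Qed.

Lemma marginal_cell v a : (a < k)%N -> marginal U v (cell a) <= k%:R^-1.
Proof.
move=> ak; have -> : k%:R^-1 = a.+1%:R / k%:R - a%:R / k%:R :> R.
  by rewrite -mulrBl -natrB // subSnn mul1r.
apply: marginal_uniform_le => //; first exact: measurable_cell.
  by rewrite ler_pM2r ?invr_gt0 // ler_nat.
move=> x /= [[h1 h2]]; rewrite !in_itv /= => /andP[x0 x1].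
apply/andP; split.
- by move: h1; case: eqP => [-> _|_ /=]; rewrite ?mul0r // in_itv /= andbT.
- move: h2; case: eqP => [-> _|_ /=]; first by rewrite divff ?gt_eqF.
  by rewrite in_itv /= => /ltW.
Qed.

Lemma cell_exists (x : R) : exists2 a, (a < k)%N & cell a x.
Proof.
exists (minn k.-1 (Num.truncn (k%:R * x))); first by rewrite gtn_min prednK ?leqnn.
split.
- case: eqP => // /eqP; rewrite -lt0n leq_min => /andP[k1 t1] /=.
  rewrite in_itv /= andbT ler_pdivrMr // [leRHS]mulrC.
  apply: (@le_trans _ _ (Num.truncn (k%:R * x))%:R); first by rewrite ler_nat geq_minr.
  by rewrite truncn_le //; move: t1; rewrite truncn_gt0; apply: le_trans.
- case: eqP => // h /=; rewrite in_itv /= ltr_pdivlMr // [ltLHS]mulrC.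
  have kt : (Num.truncn (k%:R * x) < k.-1)%N.
    by rewrite ltnNge; apply/negP => kt; apply: h; rewrite (minn_idPl kt) prednK.
  by rewrite (minn_idPr (ltnW kt)) truncnS_gt.
Qed.

(** A drop by less than [1 / k] lowers the cell index by at most one; the unbounded
end cells do not spoil this. *)
Lemma cell_drop (x y : R) a b : (a < k)%N -> cell a x -> cell b y ->
  x - k%:R^-1 < y -> (a <= b.+1)%N.
Proof.
move=> ak [ax _] [_ yb] xy; move: ax yb; case: eqP => [-> //|_ /=].
rewrite in_itv /= andbT => ax; case: eqP => [->|_ /=]; first by rewrite ltnW.
rewrite in_itv /= => yb; have : a%:R / k%:R < b.+2%:R / k%:R :> R.
  rewrite -(natr1 b.+1) mulrDl mul1r; apply: le_lt_trans ax _.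
  by rewrite -ltrBlDr (lt_trans xy).
by rewrite ltr_pM2r ?invr_gt0 // ltr_nat.
Qed.

(** [coded p a]: the cell indices along [p] form a sequence that starts at [a] and
drops by at most one at each step. *)
Fixpoint coded (p : seq 'rV[int]_n) (a : nat) : set T :=
  if p is v :: p' then
    (U v @^-1` cell a) `&`
    [set w | exists2 b, b \in [seq b <- iota 0 k | (a <= b.+1)%N] & coded p' b w]
  else setT.

(** The geometric weight [2^-b] is multiplied by at most 4 under
the transfer operator that sums over the allowed successors [b >= a - 1] of the
index [a].  This bounds the number of index sequences of length [m] by
[4^m 2^k]. *)
Lemma sum_half_powers a :
  \sum_(b <- [seq b <- iota 0 k | (a <= b.+1)%N]) (2^-1 : R) ^+ b <= 4 * 2^-1 ^+ a.
Proof.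
have p0 j : 0 <= (2^-1 : R) ^+ j by rewrite exprn_ge0.
suff H j : (if (a <= j.+1)%N then
   \sum_(b <- [seq b <- iota 0 j | (a <= b.+1)%N]) (2^-1 : R) ^+ b + 2 * 2^-1 ^+ j
   <= 4 * 2^-1 ^+ a else
   \sum_(b <- [seq b <- iota 0 j | (a <= b.+1)%N]) (2^-1 : R) ^+ b == 0).
  have := H k; case: ifP => _.
    by move/(le_trans _); apply; rewrite lerDl mulr_ge0.
  by move/eqP->; rewrite mulr_ge0.
elim: j => [|j IH].
  by case: a => [|[|a]] //=; rewrite !big_nil ?expr0 ?expr1 ?eqxx //; lra.
have -> : iota 0 j.+1 = iota 0 j ++ [:: j] by rewrite -[in LHS]addn1 iotaD.
rewrite filter_cat big_cat /=.
case: (leqP a j.+1) IH => [aj IH|aj IH].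
  rewrite (leq_trans aj (leqnSn _)) big_seq1; apply: le_trans IH.
  by rewrite exprS; lra.
rewrite big_nil addr0 (eqP IH); case: ifP => // aj2.
have -> : a = j.+2 by lia.
by rewrite !exprS; have := p0 j; lra.
Qed.

Lemma covered_coded p a : uniq p -> (a < k)%N ->
  covered U [set v | v \in p] ((4 / k%:R) ^+ size p * 2 ^+ k * 2^-1 ^+ a) (coded p a).
Proof.
elim: p a => [|v p IH] a /=.
  move=> _ ak; apply: coveredS (coveredT U set0) => //.
  rewrite expr0 mul1r exprVn -expfB // -[leLHS](expr1n _ (k - a)%N).
  by rewrite ler_pXn2r ?nnegrE // ?ler1n; lia.
case/andP=> vp up ak.
have cv : covered U [set v] k%:R^-1 (U v @^-1` cell a).
  have := covered_preimage U (measurable_cell a) (erefl : [set v] v).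
  by apply: coveredS => //; exact: marginal_cell.
have cb : covered U [set v | v \in p]
   (\sum_(b <- [seq b <- iota 0 k | (a <= b.+1)%N])
      (4 / k%:R) ^+ size p * 2 ^+ k * 2^-1 ^+ b)
   [set w | exists2 b, b \in [seq b <- iota 0 k | (a <= b.+1)%N] & coded p b w].
  apply: covered_bigU => b; rewrite mem_filter mem_iota => /and3P[_ _ bk].
  exact: IH.
apply: coveredS (coveredI _ cv cb) => //.
- by move=> u [->|up']; rewrite /= inE ?eqxx // up' orbT.
- rewrite -mulr_sumr mulrA.
  have c0 : 0 <= k%:R^-1 * ((4 / k%:R) ^+ size p * 2 ^+ k) :> R.
    by rewrite !mulr_ge0 ?exprn_ge0 ?invr_ge0 ?divr_ge0 ?ler0n.
  apply: le_trans (ler_wpM2l c0 (sum_half_powers a)) _.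
  rewrite exprS le_eqVlt; apply/orP; left; apply/eqP; ring.
- by move=> u -> up'; rewrite up' in vp.
Qed.

Lemma path_coded w u p :
  path (fun x y => U x w - k%:R^-1 < U y w) u p ->
  exists a, [/\ (a < k)%N, cell a (U u w) & coded (u :: p) a w].
Proof.
elim: p u => [|v p IH] u /=.
  have [a ak ax] := cell_exists (U u w); move=> _; exists a; split=> //; split=> //.
  by exists a => //; rewrite mem_filter mem_iota; lia.
case/andP=> uv /IH[b [bk bv bp]].
have [a ak au] := cell_exists (U u w); exists a; split=> //; split=> //.
exists b => //; rewrite mem_filter mem_iota (cell_drop ak au bv uv); lia.
Qed.

(** Distances to the origin grow by at most one per step, so a label increase forces
the uniform variable to drop by less than [theta]. *)
Lemma climbs_coded theta m w : 0 <= theta <= k%:R^-1 ->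
  climbs c (fun v => rmf_label U q theta v w) m 0 ->
  exists2 p, p \in [seq p <- walks m 0 | uniq p] &
  exists2 a, a \in iota 0 k & coded p a w.
Proof.
move=> /andP[th0 thk] /climbs_walk[p pw pp]; exists (0 :: p).
  rewrite mem_filter pw andbT.
  apply: (@sorted_uniq _ (fun x y => rmf_label U q theta x w < rmf_label U q theta y w)).
  - by move=> x y z; exact: lt_trans.
  - by move=> x; exact: ltxx.
  - by apply: sub_path pp => x y /asboolP[].
have [|a [ak _ ap]] := @path_coded w 0 p; last by exists a; rewrite ?mem_iota.
apply: sub_path pp => x y /asboolP[axy _]; rewrite /rmf_label => lxy.
have := lq_dist_adjacent q1 axy.
set dx := lq_dist q 0 x in lxy *; set dy := lq_dist q 0 y in lxy * => dxy.
have : theta * dy <= theta * dx + theta.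
  by rewrite -[X in _ + X]mulr1 -mulrDr ler_wpM2l.
by move: lxy thk; set ik := _^-1; lra.
Qed.

Lemma covered_climbs theta m : 0 <= theta <= k%:R^-1 ->
  covered U setT ((2 * n)%:R ^+ m * (k%:R * ((4 / k%:R) ^+ m.+1 * 2 ^+ k)))
    [set w | climbs c (fun v => rmf_label U q theta v w) m 0].
Proof.
move=> th; set B := (2 * n)%:R ^+ m * _.
have le_sum : \sum_(p <- [seq p <- walks m (0 : 'rV[int]_n) | uniq p])
    \sum_(a <- iota 0 k) (4 / k%:R) ^+ m.+1 * 2 ^+ k <= B.
  rewrite /B -(sum_walks _ m (0 : 'rV[int]_n)) big_filter big_mkcond; apply: ler_sum => p _.
  rewrite big_const_seq count_predT size_iota iter_addr_0 [leRHS]mulr_natl.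
  by case: ifP => // _; rewrite mulrn_wge0 // mulr_ge0 ?exprn_ge0 ?divr_ge0.
apply: (@coveredS _ _ _ P _ U setT setT) le_sum _ _.
- by [].
- by move=> w; exact: climbs_coded.
apply: covered_bigU => p; rewrite mem_filter => /andP[up pw].
apply: covered_bigU => a; rewrite mem_iota => /andP[_ ak].
apply: coveredS (covered_coded up ak) => //.
rewrite (size_walks pw) -[leRHS]mulr1; apply: ler_wpM2l.
  by apply: mulr_ge0; rewrite exprn_ge0 // divr_ge0.
by apply: exprn_ile1 => //; lra.
Qed.

End Subcritical.

Lemma geometric_bound_le0 (R : realType) (x C : R) :
  (forall m, x <= C * 2^-1 ^+ m) -> x <= 0.
Proof.
move=> h; rewrite leNgt; apply/negP => x0.
pose m := (Num.truncn (C / x)).+1.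
have Cm : C < x * m%:R by rewrite mulrC -ltr_pdivrMr // truncnS_gt.
have : x * 2 ^+ m <= C by rewrite -ler_pdivlMr ?exprn_gt0 // -exprVn; exact: h.
apply/negP; rewrite -ltNge; apply: lt_le_trans Cm _.
by rewrite ler_wpM2l ?(ltW x0) // -natrX ler_nat ltnW // ltn_expl.
Qed.

(** With [k = 16 n] cells the number [(2 n)^m] of walks times the number [4^m] of
index sequences is beaten by the probability [k^-m], leaving [2^-m]. *)
Lemma percolation_null (R : realType) (d : measure_display) (T : measurableType d)
    (P : probability T R) (n : nat) (U : 'rV[int]_n -> {RV P >-> R})
    (q : \bar R) (c : path_rule) (theta : R) :
  (0 < n)%N -> (1 <= q)%E -> iid_uniform01 U ->
  0 <= theta <= (16 * n)%:R^-1 -> P (rmf_percolation U q c theta) = 0%E.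
Proof.
move=> n0 q1 hU th; set k := (16 * n)%N in th.
have k0 : (0 < k)%N by rewrite muln_gt0.
have mperc := measurable_percolation U q c theta.
rewrite -(fineK (fin_num_measure P _ mperc)); congr (_%:E).
apply/eqP; rewrite eq_le; apply/andP; split; last exact: fine_ge0.
apply: (@geometric_bound_le0 _ _ (4 * 2 ^+ k)) => m.
have [G [mG sG PG]] := covered_bound hU.1 (covered_climbs c q1 hU k0 m th).
have lePG : (P (rmf_percolation U q c theta) <= P G)%E.
  apply: le_measure; rewrite ?inE // percolationE.
  by move=> w /(_ m I) /sG.
rewrite -lee_fin fineK ?fin_num_measure //; apply: le_trans lePG (le_trans PG _).
have nR0 : n%:R != 0 :> R by rewrite pnatr_eq0 -lt0n.
rewrite lee_fin le_eqVlt; apply/orP; left; apply/eqP.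
have -> : 2^-1 = (2 * n)%:R * (4 / k%:R) :> R by rewrite /k !natrM; field.
rewrite [in RHS]exprMn [in LHS]exprS.
have kE : k%:R * (4 / k%:R) = 4 :> R by rewrite mulrC divfK // pnatr_eq0 -lt0n.
move: (4 / k%:R) (2 ^+ k) kE => e C <-.
ring.
Qed.

(** * Oriented bond percolation through dual paths *)

Section DualPaths.
Implicit Types (z e : int * int) (k : bool * bool) (ms : seq (bool * bool)).

(** The bonds of the oriented lattice go from [z] across to [z + (1, 0)] and up to
[z + (1, 1)].  Dual paths are followed backwards, from a site to the sites that
block it.  The first boolean of a move tells whether it crosses a bond, which
then has to be closed: [(true, false)] crosses the across bond starting at
[z - (1, 0)], and [(true, true)] crosses the up bond starting at [z]. *)
Definition dual_move k z : int * int :=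
  match k with
  | (false, false) => (z.1 - 1, z.2)
  | (false, true) => (z.1 + 1, z.2 + 1)
  | (true, false) => (z.1 - 1, z.2 - 1)
  | (true, true) => (z.1 + 1, z.2)
  end.

(** Twice the deviation from the line of slope 1/2: free dual moves raise it by one,
bond-crossing dual moves lower it by one. *)
Definition height z : int := 2 * z.2 - z.1.

Fixpoint trajectory z ms : seq (int * int) :=
  if ms is k :: ms' then dual_move k z :: trajectory (dual_move k z) ms' else [::].

Fixpoint crossed_across z ms : seq (int * int) :=
  if ms is k :: ms' then
    (if k == (true, false) then [:: (z.1 - 1, z.2)] else [::]) ++
    crossed_across (dual_move k z) ms'
  else [::].

Fixpoint crossed_up z ms : seq (int * int) :=
  if ms is k :: ms' then
    (if k == (true, true) then [:: z] else [::]) ++ crossed_up (dual_move k z) ms'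
  else [::].

Lemma mem_crossed_across z ms e :
  e \in crossed_across z ms -> (e.1 + 1, e.2) \in z :: trajectory z ms.
Proof.
elim: ms z => // k ms IH z; rewrite [crossed_across _ _]/= mem_cat => /orP[|/IH].
  by case: eqP => // _; rewrite inE => /eqP ->; rewrite subrK -surjective_pairing mem_head.
by move=> h; rewrite inE h orbT.
Qed.

Lemma mem_crossed_up z ms e : e \in crossed_up z ms -> e \in z :: trajectory z ms.
Proof.
elim: ms z => // k ms IH z; rewrite [crossed_up _ _]/= mem_cat => /orP[|/IH].
  by case: eqP => // _; rewrite inE => /eqP ->; rewrite mem_head.
by move=> h; rewrite inE h orbT.
Qed.

(** A crossed bond determines the position from which it is crossed, so a
self-avoiding trajectory crosses each bond at most once. *)
Lemma uniq_crossed_across z ms :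
  uniq (z :: trajectory z ms) -> uniq (crossed_across z ms).
Proof.
elim: ms z => // k ms IH z; rewrite cons_uniq => /andP[zt /IH u].
rewrite /= cat_uniq u andbT; apply/andP; split; first by case: eqP.
apply/hasPn => e /mem_crossed_across h; case: eqP => // _; rewrite inE.
by apply: contraNneq zt => eE; move: h; rewrite eE subrK -surjective_pairing.
Qed.

Lemma uniq_crossed_up z ms : uniq (z :: trajectory z ms) -> uniq (crossed_up z ms).
Proof.
elim: ms z => // k ms IH z; rewrite cons_uniq => /andP[zt /IH u].
rewrite /= cat_uniq u andbT; apply/andP; split; first by case: eqP.
apply/hasPn => e /mem_crossed_up h; case: eqP => // _; rewrite inE.
by apply: contraNneq zt => eE; move: h; rewrite eE.
Qed.

Lemma height_trajectory z ms :
  height (last z (trajectory z ms)) =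
  height z + (size ms)%:Z -
    2 * (size (crossed_across z ms) + size (crossed_up z ms))%N%:Z.
Proof.
elim: ms z => [|k ms IH] z /=; first lia.
rewrite IH !size_cat; case: k => [[] []] /=; rewrite /height /=; lia.
Qed.

Variables closed_across closed_up : int * int -> Prop.

Definition dual_allowed k z : Prop :=
  (k = (true, false) -> closed_across (z.1 - 1, z.2)) /\
  (k = (true, true) -> closed_up z).

Definition dual_step z z' : Prop :=
  exists2 k, z' = dual_move k z & dual_allowed k z.

Definition blocked z : Prop :=
  exists2 p, path (fun x y => `[< dual_step x y >]) z p & height (last z p) < 0.

Lemma blocked_low z : height z < 0 -> blocked z.
Proof. by exists [::]. Qed.

Lemma blocked_step z z' : dual_step z z' -> blocked z' -> blocked z.
Proof. by move=> h [p pp lp]; exists (z' :: p) => //=; rewrite pp andbT; apply/asboolP. Qed.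

(** The blocked region acts as a wall below the path.  At an unblocked site resting
on the wall, the next column is again blocked one level below.  If the across
bond leads to an unblocked site it must be open, since otherwise a dual path
would cross it; if it leads to a blocked site, then the up bond must be open and
lead to an unblocked site, since otherwise the current site would be blocked. *)
Lemma frontier_advance z : ~ blocked z -> blocked (z.1, z.2 - 1) ->
  (~ closed_across z /\ ~ blocked (z.1 + 1, z.2) /\ blocked (z.1 + 1, z.2 - 1)) \/
  (~ closed_up z /\ ~ blocked (z.1 + 1, z.2 + 1) /\ blocked (z.1 + 1, z.2)).
Proof.
move=> nz bz.
have bz1 : blocked (z.1 + 1, z.2 - 1).
  by apply: blocked_step bz; exists (false, false); [rewrite /= addrK|split].
have [b1|b1] := pselect (blocked (z.1 + 1, z.2)); last first.
  left; split=> // cz; apply: b1; apply: blocked_step bz.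
  by exists (true, false); [rewrite /= addrK|split=> //= _; rewrite addrK -surjective_pairing].
right; split; last split=> //.
- by move=> cz; apply: nz; apply: blocked_step b1; exists (true, true).
- by move=> b2; apply: nz; apply: blocked_step b2; exists (false, true).
Qed.

Lemma dual_path_trajectory z p : path (fun x y => `[< dual_step x y >]) z p ->
  exists ms, [/\ p = trajectory z ms,
      forall e, e \in crossed_across z ms -> closed_across e &
      forall e, e \in crossed_up z ms -> closed_up e].
Proof.
elim: p z => [|y p IH] z /=; first by move=> _; exists [::].
case/andP=> /asboolP[k -> [kH kD]] /IH[ms [-> aH aD]]; exists (k :: ms); split=> //.
- move=> e /=; rewrite mem_cat => /orP[|/aH//].
  by case: eqP => // /kH h; rewrite inE => /eqP ->.
- move=> e /=; rewrite mem_cat => /orP[|/aD//].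
  by case: eqP => // /kD h; rewrite inE => /eqP ->.
Qed.

Lemma blocked_trajectory z : blocked z -> exists ms,
  [/\ uniq (z :: trajectory z ms), height (last z (trajectory z ms)) < 0,
      forall e, e \in crossed_across z ms -> closed_across e &
      forall e, e \in crossed_up z ms -> closed_up e].
Proof.
case=> p /shortenP[p' pp' up' _] h.
by have [ms [pE aH aD]] := dual_path_trajectory pp'; exists ms; rewrite -pE.
Qed.

End DualPaths.

Section PeierlsBound.
Context (d : measure_display) (T : measurableType d) (R : realType).
Context (P : probability T R) (I : eqType) (X : I -> {RV P >-> R}).
Context (QH QD : int * int -> set I) (H D : int * int -> set T).
Hypotheses (indX : mutually_independent X)
  (dQH : forall e e' i, QH e i -> QH e' i -> e = e')
  (dQD : forall e e' i, QD e i -> QD e' i -> e = e')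
  (cH : forall e, covered X (QH e) (16^-1 ^+ 4) (H e))
  (cD : forall e, covered X (QD e) (16^-1 ^+ 4) (D e)).

Definition blocking_trajectory (ms : seq (bool * bool)) : set T :=
  [set w | [/\ uniq ((0, 0) :: trajectory (0, 0) ms),
     height (last (0, 0) (trajectory (0, 0) ms)) < 0,
     forall e, e \in crossed_across (0, 0) ms -> H e w &
     forall e, e \in crossed_up (0, 0) ms -> D e w]].

(** Among [N] moves that lower the height in total more than half cross a closed
bond, so more than a quarter of [N] distinct bonds of one of the two kinds are
closed.  Bonds of one kind are based on disjoint sets of sites, so their weights
multiply. *)
Lemma covered_blocking_trajectory ms :
  covered X setT (16^-1 ^+ (size ms).+1) (blocking_trajectory ms).
Proof.
set z : int * int := (0, 0).
have [u|nu] := boolP (uniq (z :: trajectory z ms)); last first.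
  apply: coveredW (covered0 X setT); first by rewrite exprn_ge0.
  by move=> w [h]; rewrite h in nu.
have [h|nh] := boolP (height (last z (trajectory z ms)) < 0); last first.
  apply: coveredW (covered0 X setT); first by rewrite exprn_ge0.
  by move=> w [_ h]; rewrite h in nh.
rewrite height_trajectory /height in h.
have small m : (size ms < 4 * m)%N -> (16^-1 ^+ 4) ^+ m <= 16^-1 ^+ (size ms).+1 :> R.
  move=> hm; rewrite -exprM; apply: ler_wiXn2l => //; lra.
have [hc|hc] : (size ms < 4 * size (crossed_across z ms))%N \/
  (size ms < 4 * size (crossed_up z ms))%N by move: h; rewrite /=; lia.
- have := covered_bigI (uniq_crossed_across u) dQH (fun e _ => cH e).
  rewrite big_const_seq count_predT iter_mulr_1.
  by apply: coveredS => //; [exact: small|move=> w []].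
- have := covered_bigI (uniq_crossed_up u) dQD (fun e _ => cD e).
  rewrite big_const_seq count_predT iter_mulr_1.
  by apply: coveredS => //; [exact: small|move=> w []].
Qed.

(** Peierls sum: there are [4^N] move sequences of length [N], each of weight at
most [16^-(N+1)]. *)
Lemma blocked_origin_bound : exists G, [/\ measurable G,
  [set w | blocked (H^~ w) (D^~ w) (0, 0)] `<=` G & (P G <= (8^-1)%:E)%E].
Proof.
(* The weight is put into the form [e / 2^(N+1)] so that the series sums to [e]. *)
pose F N := [set w | exists2 ms, ms \in [seq val t | t : N.-tuple (bool * bool)] &
  blocking_trajectory ms w].
have cF N : covered X setT (8^-1 / (2 ^ N.+1)%:R) (F N).
  have := covered_bigU (r := [seq val t | t : N.-tuple (bool * bool)])
    (fun ms _ => covered_blocking_trajectory ms).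
  apply: coveredW => //; rewrite big_map big_enum /=.
  rewrite (eq_bigr (fun=> 16^-1 ^+ N.+1)); last by move=> t _; rewrite size_tuple.
  rewrite sumr_const card_tuple card_prod card_bool -[leLHS]mulr_natl natrX.
  have -> : (2 * 2)%:R ^+ N * 16^-1 ^+ N.+1 = 16^-1 * 4^-1 ^+ N :> R.
    rewrite exprS mulrCA -exprMn; congr (_ * _ ^+ _); lra.
  have -> : 8^-1 / (2 ^ N.+1)%:R = 16^-1 * 2^-1 ^+ N :> R.
    by rewrite natrX exprS exprVn; field; rewrite expf_neq0.
  apply: ler_wpM2l; first lra.
  by apply: lerXn2r; rewrite ?nnegrE; lra.
have [G hG] := choice (fun N => covered_bound indX (cF N)).
have mG : measurable (\bigcup_N G N) by apply: bigcupT_measurable => N; case: (hG N).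
exists (\bigcup_N G N); split=> //.
- move=> w /blocked_trajectory[ms hms]; exists (size ms) => //.
  have [_ + _] := hG (size ms); apply; exists ms => //.
  by apply/mapP; exists (in_tuple ms); rewrite ?mem_enum.
- apply: le_trans (generalized_Boole_inequality P _ mG) _; first by move=> N; case: (hG N).
  have e8 : 0 <= 8^-1 :> R by lra.
  have := @epsilon_trick R (fun=> 0%E) 8^-1 xpredT (fun=> lexx _) e8.
  rewrite [X in (_ <= X + _)%E]eseries0 // add0e => le8; apply: le_trans le8.
  by apply: lee_nneseries => // N _; rewrite add0e; case: (hG N).
Qed.

End PeierlsBound.

(** * Blocks of the lattice as bonds *)

Section PlaneEmbedding.
Context (n : nat) (hn : (2 <= n)%N).

Definition plane_point (s : int * int) : 'rV[int]_n := \row_i plane_vec s.1 s.2 i.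

Let i0 : 'I_n := Ordinal (ltn_trans (ltnSn 0) hn).
Let i1 : 'I_n := Ordinal hn.

Lemma plane_point_inj : injective plane_point.
Proof.
move=> [a r] [a' r'] /rowP h.
by have := h i0; have := h i1; rewrite !mxE /plane_vec /= => -> ->.
Qed.

Lemma l1norm_plane_point s : l1norm (plane_point s) = (`|s.1| + `|s.2|)%N.
Proof.
rewrite /l1norm (bigD1 i0) //= (bigD1 i1) //= !mxE /plane_vec /=.
rewrite big1 ?addn0 // => i /andP[ni0 ni1]; rewrite !mxE.
rewrite -!(inj_eq val_inj) /= in ni0 ni1.
by rewrite /plane_vec (negbTE ni0) (negbTE ni1).
Qed.

Lemma plane_pointB s t :
  plane_point s - plane_point t = plane_point (s.1 - t.1, s.2 - t.2).
Proof.
apply/rowP => i; rewrite !mxE /plane_vec /=.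
by case: eqP => _ //; case: eqP => _ //; rewrite subrr.
Qed.

Lemma plane_point0 : plane_point (0, 0) = 0.
Proof. by apply/rowP => i; rewrite !mxE /plane_vec; case: eqP => _ //; case: eqP. Qed.

Lemma lq_dist_plane_point (R : realType) (q : \bar R) s : (1 <= q)%E ->
  lq_dist q 0 (plane_point s) =
  rnorm q (plane_vec (s.1%:~R : R) s.2%:~R : 'I_n -> R).
Proof.
move=> q1; rewrite lq_dist0 //; congr (rnorm q _); apply: funext => i.
by rewrite mxE /plane_vec; case: eqP => _ //; case: eqP.
Qed.

End PlaneEmbedding.

Section BlockSites.
Variable M : nat.

Definition row_segment (x y : int) (m k : nat) : seq (int * int) :=
  [seq (x + j%:Z, y) | j <- iota m k].

Lemma mem_row_segment x y m k s : reflect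
  (exists2 j : nat, (m <= j < m + k)%N & s = (x + j%:Z, y)) (s \in row_segment x y m k).
Proof.
apply: (iffP mapP) => [[j jm ->]|[j jm ->]]; exists j => //; by rewrite mem_iota in jm *.
Qed.

(** The shift by one keeps all blocks away from the vertical axis, so that the sites
at height at most [2 i + 2] of block [i] lie in the cone [M * y <= x]. *)
Definition block_start (i : int) : int := (i + 1) * (2 * M)%N%:Z.

(** A block occupies the columns [block_start i + 1, ..., block_start i + 2 M]; its
entry column belongs to the preceding block. *)
Definition across_sites (z : int * int) : seq (int * int) :=
  row_segment (block_start z.1) (2 * z.2) 1 (2 * M).

(** The route of an up bond: the left half of row [2 b], then row [2 b + 1], then the
right half of row [2 b + 2].  Consecutive up bonds use complementary halves of
the even rows, which makes the site sets of distinct up bonds disjoint. *)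
Definition up_sites (z : int * int) : seq (int * int) :=
  row_segment (block_start z.1) (2 * z.2) 1 M ++
  row_segment (block_start z.1) (2 * z.2 + 1) 1 (2 * M) ++
  row_segment (block_start z.1) (2 * z.2 + 2) M.+1 M.

Lemma across_sites_inj e e' s : s \in across_sites e -> s \in across_sites e' -> e = e'.
Proof.
case: e e' => [i b] [i' b'].
move=> /mem_row_segment[j jm ->] /mem_row_segment[j' jm' []]; rewrite /block_start /=.
move=> h1 h2; have ii : i = i' by nia.
by subst i'; congr pair; lia.
Qed.

(** A site determines its block from its column, and then the level from the parity
of its row and the half of the block it lies in. *)
Lemma up_sites_inj e e' s : s \in up_sites e -> s \in up_sites e' -> e = e'.
Proof.
have H z t : t \in up_sites z -> exists j : nat, [/\ (0 < j <= 2 * M)%N,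
    t.1 = block_start z.1 + j%:Z &
    if (j <= M)%N then t.2 = 2 * z.2 \/ t.2 = 2 * z.2 + 1
    else t.2 = 2 * z.2 + 1 \/ t.2 = 2 * z.2 + 2].
  rewrite !mem_cat => /or3P[] /mem_row_segment[j jm ->]; exists j; split=> //=; try lia.
  - by rewrite ifT; [left|lia].
  - by case: ifP => _; [right|left].
  - by rewrite ifF; [right|lia].
case: e e' => [i b] [i' b'] /H[j [jm s1 s2]] /H[j' [jm' s1' s2']].
rewrite /block_start /= in s1 s2 s1' s2'.
have ii : i = i' by nia.
subst i'; have jj : j = j' by lia.
by subst j'; congr pair; move: s2 s2'; case: ifP => _; lia.
Qed.

End BlockSites.

Section Blocks.
Context (d : measure_display) (T : measurableType d) (R : realType).
Context (P : probability T R) (W : int * int -> {RV P >-> R}).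
Hypothesis hW : iid_uniform01 W.
Variables (M : nat) (g : R).
Hypothesis g01 : 0 <= g <= 2^-1.

Definition good : set R := `[0, 1 - 2 * g[%classic.

Definition some_bad (r : seq (int * int)) : set T :=
  [set w | exists2 s, s \in r & ~ good (W s w)].

(** Comparison with the threshold 1/2, rather than directly between the two
variables, keeps the complement a union of two cylinders of total weight 3/4. *)
Definition crossing (s : int * int) (w : T) : Prop :=
  W s w < 2^-1 <= W (s.1, s.2 + 1) w.

Definition no_crossing (r : seq (int * int)) : set T :=
  [set w | forall s, s \in r -> ~ crossing s w].

Definition closed_across (z : int * int) : set T := some_bad (across_sites M z).

Definition closed_up (z : int * int) : set T :=
  some_bad (up_sites M z) `|`
  no_crossing (row_segment (block_start M z.1) (2 * z.2) 1 M) `|`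
  no_crossing (row_segment (block_start M z.1) (2 * z.2 + 1) M.+1 M).

Lemma covered_some_bad r : covered W [set s | s \in r] ((size r)%:R * (2 * g)) (some_bad r).
Proof.
have -> : (size r)%:R * (2 * g) = \sum_(s <- r) 2 * g.
  by rewrite big_const_seq count_predT iter_addr_0 mulr_natl.
apply: covered_bigU => s sr.
have mgood : measurable (~` good) by apply: measurableC; exact: measurable_itv.
have := @covered_preimage _ _ _ _ _ W [set s | s \in r] s _ mgood sr.
apply: coveredW; last by [].
have /andP[g0 g1] := g01.
have -> : 2 * g = 1 - (1 - 2 * g) by ring.
apply: marginal_uniform_le => //; first by lra.
move=> x [+]; rewrite /good /= !in_itv /= => h /andP[x0 x1]; rewrite x1 andbT.
by rewrite leNgt; apply/negP => xg; apply: h; rewrite x0 xg.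
Qed.

(** The complement splits into the disjoint cases [W s >= 1/2], of weight 1/2, and
[W s < 1/2] together with [W (s + (0, 1)) < 1/2], of weight 1/4. *)
Lemma covered_no_crossing_at s :
  covered W [set t | t = s \/ t = (s.1, s.2 + 1)] (3 / 4) [set w | ~ crossing s w].
Proof.
set Q := [set t | _].
have hi : measurable (`[2^-1, +oo[%classic : set R) by [].
have lo : measurable (`]-oo, 2^-1[%classic : set R) by [].
have m_lo t : marginal W t `]-oo, 2^-1[%classic <= 2^-1.
  rewrite -[leRHS]subr0; apply: marginal_uniform_le => //.
  by move=> x /= []; rewrite !in_itv /= => /ltW -> /andP[->].
have m_hi t : marginal W t `[2^-1, +oo[%classic <= 2^-1.
  have -> : 2^-1 = 1 - 2^-1 :> R by lra.
  apply: marginal_uniform_le => //; first lra.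
  by move=> x /= []; rewrite !in_itv /= andbT => + /andP[_ ->]; rewrite andbT; lra.
have c1 : covered W Q 2^-1 (W s @^-1` `[2^-1, +oo[).
  have := @covered_preimage _ _ _ _ _ W Q s _ hi (or_introl erefl).
  by apply: coveredW.
have cs : covered W [set s] 2^-1 (W s @^-1` `]-oo, 2^-1[).
  have := @covered_preimage _ _ _ _ _ W [set s] s _ lo erefl.
  by apply: coveredW.
have ct : covered W [set (s.1, s.2 + 1)] 2^-1 (W (s.1, s.2 + 1) @^-1` `]-oo, 2^-1[).
  have := @covered_preimage _ _ _ _ _ W [set (s.1, s.2 + 1)] _ _ lo erefl.
  by apply: coveredW.
have c2 : covered W Q (2^-1 * 2^-1)
    ((W s @^-1` `]-oo, 2^-1[) `&` (W (s.1, s.2 + 1) @^-1` `]-oo, 2^-1[)).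
  apply: coveredS (coveredI _ cs ct) => //.
  by move=> t -> /=; case: (s) => a b /= [] /eqP; lia.
apply: coveredW (coveredU c1 c2); first lra.
move=> w /=; rewrite /crossing !in_itv /= andbT => h.
case: (leP 2^-1 (W s w)) => hs; first by left.
by right; split=> //; rewrite ltNge; apply/negP => ht; apply: h; rewrite hs.
Qed.

Lemma covered_no_crossing x y m k : covered W
  [set t | exists2 s, s \in row_segment x y m k & t = s \/ t = (s.1, s.2 + 1)]
  ((3 / 4) ^+ k) (no_crossing (row_segment x y m k)).
Proof.
have := covered_bigI (r := iota m k)
  (Q := fun j => [set t | t = (x + j%:Z, y) \/ t = (x + j%:Z, y + 1)])
  (iota_uniq _ _) _ (fun j _ => covered_no_crossing_at (x + j%:Z, y)).
rewrite big_const_seq count_predT iter_mulr_1 size_iota => h.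
apply: coveredS (h _) => //.
- move=> t [j jm ht]; exists (x + j%:Z, y) => //.
  by apply/mapP; exists j.
- by move=> w hw j jm; apply: hw; apply/mapP; exists j.
- by move=> j j' t [->|->] [] []; lia.
Qed.

Lemma covered_closed_across z : covered W [set s | s \in across_sites M z]
  ((2 * M)%:R * (2 * g)) (closed_across z).
Proof. by have := covered_some_bad (across_sites M z); rewrite size_map size_iota. Qed.

Lemma covered_closed_up z : covered W [set s | s \in up_sites M z]
  ((4 * M)%:R * (2 * g) + 2 * (3 / 4) ^+ M) (closed_up z).
Proof.
have := covered_some_bad (up_sites M z); rewrite !size_cat !size_map !size_iota.
have -> : (M + (2 * M + M) = 4 * M)%N by lia.
have c1 := covered_no_crossing (block_start M z.1) (2 * z.2) 1 M.
have c2 := covered_no_crossing (block_start M z.1) (2 * z.2 + 1) M.+1 M.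
move=> c0.
have {}c1 : covered W [set s | s \in up_sites M z] ((3 / 4) ^+ M)
   (no_crossing (row_segment (block_start M z.1) (2 * z.2) 1 M)).
  apply: coveredS c1 => // t [s sr [->|->]] /=; rewrite !mem_cat ?sr //.
  move/mem_row_segment: sr => [j jm ->]; apply/orP; right; apply/orP; left.
  by apply/mem_row_segment; exists j => //; lia.
have {}c2 : covered W [set s | s \in up_sites M z] ((3 / 4) ^+ M)
   (no_crossing (row_segment (block_start M z.1) (2 * z.2 + 1) M.+1 M)).
  apply: coveredS c2 => // t [s sr [->|->]] /=; rewrite !mem_cat; apply/orP; right; apply/orP.
    left; move/mem_row_segment: sr => [j jm ->].
    by apply/mem_row_segment; exists j => //; lia.
  right; move/mem_row_segment: sr => [j jm ->].
  by apply/mem_row_segment; exists j => //=; congr pair; lia.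
by apply: coveredW (coveredU (coveredU c0 c1) c2) => //; lra.
Qed.

End Blocks.

(** * Increasing paths through open blocks *)

Section ClimbingInBlocks.
Context (d : measure_display) (T : measurableType d) (R : realType).
Context (P : probability T R) (n : nat) (U : 'rV[int]_n -> {RV P >-> R}).
Variables (q : \bar R) (c : path_rule).
Hypotheses (hn : (2 <= n)%N) (q1 : (1 <= q)%E).
Variables (M : nat) (g theta : R).
Hypotheses (M0 : (0 < M)%N) (g01 : 0 <= g <= 2^-1) (htheta : 1 - g <= theta).
Hypothesis radial_step : forall a b : R, 0 < a -> 0 <= b -> M%:R * b <= a ->
  rnorm q (plane_vec a b : 'I_n -> R) + (1 - g) <= rnorm q (plane_vec (a + 1) b : 'I_n -> R).

Local Notation W := (fun s => U (plane_point n s)).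
Variable w : T.
Local Notation F := (fun v => rmf_label U q theta v w).
Local Notation good := (good g).

(** The label changes by [W (a + 1, r) - W (a, r)] plus at least
[(1 - g)^2 >= 1 - 2 g], and [good] makes the first difference exceed
[-(1 - 2 g)].  At the origin, where [radial_step] says nothing, the norm
increases by exactly one. *)
Lemma across_step (a r : int) : 0 <= r -> M%:Z * r <= a ->
  good (W (a, r) w) -> good (W (a + 1, r) w) ->
  up_step c F (plane_point n (a, r)) (plane_point n (a + 1, r)).
Proof.
move=> r0 Mr; have a0 : 0 <= a by nia.
rewrite /good /= !in_itv /= => /andP[_ Wa] /andP[Wa' _]; split.
- rewrite /Defs.adjacent plane_pointB l1norm_plane_point //=; lia.
- by case: c => //; rewrite !l1norm_plane_point //=; lia.
have dist_step : lq_dist q 0 (plane_point n (a, r)) + (1 - g) <=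
    lq_dist q 0 (plane_point n (a + 1, r)).
  rewrite !lq_dist_plane_point //= rmorphD /=.
  have [a00|an0] := eqVneq a 0.
    have r00 : r = 0 by nia.
    rewrite a00 r00 !add0r.
    have -> : (plane_vec 0%:~R 0%:~R : 'I_n -> R) = (fun i => 0 * plane_vec 0%:~R 0%:~R i).
      by apply: funext => i; rewrite mul0r /plane_vec; case: eqP => // _; case: eqP.
    rewrite rnormZ // mul0r add0r.
    apply: (@le_trans _ _ 1); first by move/andP: g01 => [? ?]; lra.
    exact: le_plane_norm.
  apply: radial_step; rewrite ?ltr0z ?ler0z //; first lia.
  have -> : M%:R * r%:~R = (M%:Z * r)%:~R :> R by rewrite rmorphM.
  by rewrite ler_int.
have d0 : 0 <= lq_dist q 0 (plane_point n (a, r)).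
  by rewrite lq_dist_plane_point // rnorm_ge0.
rewrite /rmf_label.
move: dist_step d0 Wa Wa'; set x := lq_dist _ _ _; set y := lq_dist _ _ _.
move: g01 => /andP[g0 g1] h1 h2 h3 h4.

have : (1 - g) * (1 - g) <= theta * (y - x) 
  by (apply: ler_pM; [lra|lra|exact: htheta|lra]).
have : 0 <= g * g by exact: mulr_ge0.
by rewrite mulrBr; lra.
Qed.

Lemma up_step_crossing (a r : int) : 0 <= r -> 0 <= a -> crossing W (a, r) w ->
  up_step c F (plane_point n (a, r)) (plane_point n (a, r + 1)).
Proof.
move=> r0 a0 /andP[Wlo Whi]; split.
- rewrite /Defs.adjacent plane_pointB l1norm_plane_point //=; lia.
- by case: c => //; rewrite !l1norm_plane_point //=; lia.
rewrite /rmf_label; apply: ltr_leD; first exact: lt_le_trans Whi.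
apply: ler_wpM2l; first by have := htheta; move/andP: g01 => [? ?]; lra.
rewrite !lq_dist_plane_point //=; apply: plane_norm_mono => //.
  by rewrite ler0z a0 lexx.
by rewrite ler0z r0 ler_int; lia.
Qed.

Lemma climbs_row (a r : int) k m : 0 <= r -> M%:Z * r <= a ->
  (forall j : nat, (j <= k)%N -> good (W (a + j%:Z, r) w)) ->
  climbs c F m (plane_point n (a + k%:Z, r)) ->
  climbs c F m (plane_point n (a, r)).
Proof.
move=> r0 Mr; elim: k => [|k IH] hg hk; first by rewrite addr0 in hk.
apply: IH => [j jk|]; first by apply: hg; lia.
apply: climbsW; exists (plane_point n (a + k%:Z + 1, r)).
  apply: across_step => //; first lia.
    by apply: hg.
  by have := hg k.+1 (leqnn _); rewrite (_ : a + k.+1%:Z = a + k%:Z + 1) //; lia.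
by rewrite (_ : a + k%:Z + 1 = a + k.+1%:Z) //; lia.
Qed.

(** A row of positive length turns a climb of length [m] from its end into one of
length [m + 1] from its start; longer climbs are truncated. *)
Lemma climbs_row_step (a r : int) k m : 0 <= r -> M%:Z * r <= a -> (0 < k)%N ->
  (forall j : nat, (j <= k)%N -> good (W (a + j%:Z, r) w)) ->
  climbs c F m (plane_point n (a + k%:Z, r)) ->
  climbs c F m.+1 (plane_point n (a, r)).
Proof.
move=> r0 Mr; case: k => // k _ hg hk.
apply: (@climbs_row _ _ k) => // [j jk|]; first by apply: hg; lia.
exists (plane_point n (a + k%:Z + 1, r)).
  apply: across_step => //; first lia.
    by apply: hg.
  by have := hg k.+1 (leqnn _); rewrite (_ : a + k.+1%:Z = a + k%:Z + 1) //; lia.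
by rewrite (_ : a + k%:Z + 1 = a + k.+1%:Z) //; lia.
Qed.

Lemma not_some_bad r s : ~ some_bad W g r w -> s \in r -> good (W s w).
Proof. by move=> h sr; apply: contrapT => ng; apply: h; exists s. Qed.

Lemma not_no_crossing x y m k : ~ no_crossing W (row_segment x y m k) w ->
  exists2 j : nat, (m <= j < m + k)%N & crossing W (x + j%:Z, y) w.
Proof.
move=> /existsNP[s /not_implyP[/mem_row_segment[j jm ->] /contrapT h]].
by exists j.
Qed.

Lemma block_startS i : block_start M (i + 1) = block_start M i + (2 * M)%N%:Z.
Proof. by rewrite /block_start; ring. Qed.

Lemma climbs_open_across (z : int * int) m : 0 <= z.2 <= z.1 ->
  good (W (block_start M z.1, 2 * z.2) w) -> ~ closed_across W M g z w ->
  good (W (block_start M (z.1 + 1), 2 * z.2) w) /\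
  (climbs c F m (plane_point n (block_start M (z.1 + 1), 2 * z.2)) ->
   climbs c F m.+1 (plane_point n (block_start M z.1, 2 * z.2))).
Proof.
case: z => i b /= /andP[b0 bi] g0 /not_some_bad hg.
have hj (j : nat) : (j <= 2 * M)%N -> good (W (block_start M i + j%:Z, 2 * b) w).
  case: j => [|j] hj; first by rewrite addr0.
  by apply: hg; apply/mem_row_segment; exists j.+1 => //; lia.
rewrite block_startS; split; first exact: hj.
by apply: climbs_row_step => //; rewrite /block_start; nia.
Qed.

(** The path runs along row [2 b] up to the first crossing column, moves up, runs
along row [2 b + 1] to a crossing column in the right half of the block, moves up
again and runs along row [2 b + 2] to the end of the block. *)
Lemma climbs_open_up (z : int * int) m : 0 <= z.2 <= z.1 ->
  good (W (block_start M z.1, 2 * z.2) w) -> ~ closed_up W M g z w ->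
  good (W (block_start M (z.1 + 1), 2 * (z.2 + 1)) w) /\
  (climbs c F m (plane_point n (block_start M (z.1 + 1), 2 * (z.2 + 1))) ->
   climbs c F m.+1 (plane_point n (block_start M z.1, 2 * z.2))).
Proof.
case: z => i b /= /andP[b0 bi] g0.
move=> /not_orP[/not_orP[/not_some_bad hg /not_no_crossing[j1 j1m cr1]]].
move=> /not_no_crossing[j2 j2m cr2].
set x := block_start M i in hg cr1 cr2 g0 *.
have xE : x = (i + 1) * (2 * M)%N%:Z by [].
have row0 (j : nat) : (j <= M)%N -> good (W (x + j%:Z, 2 * b) w).
  case: j => [|j] jM; first by rewrite addr0.
  apply: hg; rewrite !mem_cat; apply/orP; left.
  by apply/mem_row_segment; exists j.+1 => //; lia.
have row1 (j : nat) : (0 < j <= 2 * M)%N -> good (W (x + j%:Z, 2 * b + 1) w).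
  move=> jM; apply: hg; rewrite !mem_cat; apply/or3P; apply: Or32.
  by apply/mem_row_segment; exists j => //; lia.
have row2 (j : nat) : (M < j <= 2 * M)%N -> good (W (x + j%:Z, 2 * (b + 1)) w).
  move=> jM; apply: hg; rewrite !mem_cat; apply/or3P; apply: Or33.
  by apply/mem_row_segment; exists j => /=; [lia|congr pair; lia].
rewrite block_startS -/x; split; first by apply: row2; lia.
move=> h.
have h2 : climbs c F m (plane_point n (x + j2%:Z, 2 * (b + 1))).
  apply: (@climbs_row _ _ (2 * M - j2)); [lia|nia| |].
    move=> j jk; rewrite -addrA -PoszD; apply: row2; lia.
  by rewrite -addrA -PoszD subnKC //; lia.
have h1 : climbs c F m (plane_point n (x + j1%:Z, 2 * b + 1)).
  apply: (@climbs_row _ _ (j2 - j1)); [lia|nia| |].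
    move=> j jk; rewrite -addrA -PoszD; apply: row1; lia.
  rewrite -addrA -PoszD subnKC; last lia.
  apply: climbsW; exists (plane_point n (x + j2%:Z, 2 * b + 1 + 1)).
    by apply: up_step_crossing => //; nia.
  by rewrite (_ : 2 * b + 1 + 1 = 2 * (b + 1)) //; lia.
suff: climbs c F m.+1 (plane_point n (x, 2 * b)) by [].
apply: (@climbs_row _ _ j1); [lia|nia| |].
  by move=> j jk; apply: row0; lia.
exists (plane_point n (x + j1%:Z, 2 * b + 1)) => //.
by apply: up_step_crossing => //; nia.
Qed.

Local Notation blocked :=
  (blocked ((closed_across W M g)^~ w) ((closed_up W M g)^~ w)).

Lemma climbs_frontier m (z : int * int) : 0 <= z.2 <= z.1 ->
  good (W (block_start M z.1, 2 * z.2) w) ->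
  ~ blocked z -> blocked (z.1, z.2 - 1) ->
  climbs c F m (plane_point n (block_start M z.1, 2 * z.2)).
Proof.
elim: m z => // m IH z zpos gz nbz bz.
have [[nc [nb b]]|[nc [nb b]]] := frontier_advance nbz bz.
- have [g' climb] := climbs_open_across m zpos gz nc.
  by apply: climb; apply: (IH (z.1 + 1, z.2)) => //=; lia.
- have [g' climb] := climbs_open_up m zpos gz nc.
  apply: climb; apply: (IH (z.1 + 1, z.2 + 1)) => //=; first lia.
  by rewrite addrK.
Qed.

(** The initial row of good sites leads from the origin to the first block, whose
lower neighbour is blocked because it has negative height. *)
Lemma percolation_unblocked :
  ~ some_bad W g (row_segment 0 0 0 (2 * M).+1) w -> ~ blocked (0, 0) ->
  rmf_percolation U q c theta w.
Proof.
move=> /not_some_bad hg nb.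
have hj (j : nat) : (j <= 2 * M)%N -> good (W (0 + j%:Z, 0) w).
  by move=> hj; apply: hg; apply/mem_row_segment; exists j => //; lia.
rewrite percolationE => m _ /=; rewrite -(plane_point0 n).
apply: (@climbs_row _ _ (2 * M)) => //.
have -> : (0 + (2 * M)%N%:Z, 0) = (block_start M 0, 2 * 0) :> (int * int)%type.
  by rewrite /block_start; congr pair; lia.
apply: (@climbs_frontier m (0, 0)) => //=.
- by have := hj (2 * M)%N (leqnn _); rewrite /block_start mulr0 !add0r mul1r.
- by apply: blocked_low.
Qed.

End ClimbingInBlocks.

(** * Percolation for parameters close to one *)

Section Reindexing.
Context (d : measure_display) (T : measurableType d) (R : realType).
Context (P : probability T R) (I J : eqType) (U : I -> {RV P >-> R}) (f : J -> I).

Lemma iid_uniform01_comp : injective f -> iid_uniform01 U ->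
  iid_uniform01 (fun j => U (f j)).
Proof.
move=> finj [ind unif]; split; last by move=> j; exact: unif.
move=> s A us mA.
pose B i := if pselect (exists j, f j = i) is left h then A (projT1 (cid h)) else setT.
have BE j : B (f j) = A j.
  rewrite /B; case: pselect => [h|[]]; last by exists j.
  by rewrite (finj _ _ (projT2 (cid h))).
have mB i : measurable (B i) by rewrite /B; case: pselect.
have := ind (map f s) B; rewrite map_inj_uniq // => /(_ us mB).
rewrite !big_map => h; transitivity (P (\big[setI/setT]_(j <- s) (U (f j) @^-1` B (f j)))).
  by congr (P _); apply: eq_bigr => j _; rewrite BE.
by rewrite h; apply: eq_bigr => j _; rewrite BE.
Qed.

End Reindexing.

(** Choice of scales.  An up bond is closed with probability at most
[8 M g + 2 (3/4)^M].  The bound [16^-4] required by the Peierls sum follows from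
[M * g = gamma = 16^-4 / 32] together with [(3/4)^54 <= 2^-18], and
[plane_norm_step] allows the defect [g = gamma / M] once [M] is large. *)
Lemma percolation_positive (R : realType) (d : measure_display) (T : measurableType d)
    (P : probability T R) (n : nat) (U : 'rV[int]_n -> {RV P >-> R})
    (q : \bar R) (c : path_rule) :
  (2 <= n)%N -> (1 <= q)%E -> iid_uniform01 U ->
  exists2 g : R, 0 < g & forall theta, 1 - g <= theta ->
    (0 < P (rmf_percolation U q c theta))%E.
Proof.
move=> hn q1 hU.
pose gamma : R := 16^-1 ^+ 4 / 32.
have gE : gamma = 16^-1 ^+ 4 / 32 by [].
have gamma0 : 0 < gamma by rewrite gE; lra.
have [M0 hM0] := plane_norm_step hn q1 gamma0.
pose M := maxn M0.+1 54.
have M54 : (54 <= M)%N by exact: leq_maxr.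
have M0M : (M0 < M)%N by exact: leq_maxl.
have Mpos : (0 < M)%N by exact: leq_trans M54.
clearbody M.
have MR : 54 <= M%:R :> R by rewrite ler_nat.
pose g := gamma / M%:R.
have gE' : g = gamma / M%:R by [].
have Mg : M%:R * g = gamma by rewrite /g mulrC divfK // gt_eqF //; lra.
have g0 : 0 < g by rewrite divr_gt0 //; lra.
have g_le : 54 * g <= gamma by rewrite -Mg ler_wpM2r // ltW.
clearbody g.
have g01 : 0 <= g <= 2^-1 by apply/andP; split; lra.
(* [(3/4)^3 <= 1/2] *)
have pow34 : (3 / 4) ^+ M <= 2^-1 ^+ 18 :> R.
  apply: (@le_trans _ _ ((3 / 4) ^+ (3 * 18))).
    by apply: ler_wiXn2l => //; lra.
  by rewrite exprM; apply: lerXn2r; rewrite ?nnegrE; lra.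
have hW := iid_uniform01_comp (@plane_point_inj n hn) hU.
set W := fun s => U (plane_point n s) in hW.
have cH e : covered W [set s | s \in across_sites M e] (16^-1 ^+ 4) (closed_across W M g e).
  apply: coveredW (covered_closed_across hW M g01 e) => //.
  by rewrite natrM; lra.
have cD e : covered W [set s | s \in up_sites M e] (16^-1 ^+ 4) (closed_up W M g e).
  apply: coveredW (covered_closed_up hW M g01 e) => //.
  by rewrite natrM; lra.
have [G1 [mG1 sG1 PG1]] := blocked_origin_bound hW.1
  (@across_sites_inj M) (@up_sites_inj M) cH cD.
have [G2 [mG2 sG2 PG2]] := covered_bound hW.1
  (covered_some_bad hW g01 (row_segment 0 0 0 (2 * M).+1)).
exists g => // theta htheta.
have mperc := measurable_percolation U q c theta.
have cover : setT `<=` rmf_percolation U q c theta `|` (G1 `|` G2).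
  move=> w _; have [w1|nw1] := pselect (G1 w); first by right; left.
  have [w2|nw2] := pselect (G2 w); first by right; right.
  left; apply: (percolation_unblocked c hn q1 Mpos g01 htheta).
  - by rewrite gE'; move=> a b a0 b0 Mba; have := hM0 M M0M a b a0 b0 Mba.
  - by move=> /sG2.
  - by move=> /sG1.
rewrite lt_def measure_ge0 andbT; apply/eqP => P0.
have : (1 <= P (rmf_percolation U q c theta `|` (G1 `|` G2)))%E.
  rewrite -(probability_setT P); apply: le_measure; rewrite ?inE //.
  by apply: measurableU => //; exact: measurableU.
apply/negP; rewrite -ltNge.
have m12 : measurable (G1 `|` G2) by exact: measurableU.
have PU : (P (rmf_percolation U q c theta `|` (G1 `|` G2)) <=
    0 + ((8^-1)%:E + ((size (row_segment 0 0 0 (2 * M).+1))%:R * (2 * g))%:E))%E.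
  apply: le_trans (measureU2 P mperc m12) (leeD _ _); first by rewrite -P0.
  exact: le_trans (measureU2 P mG1 mG2) (leeD PG1 PG2).
apply: le_lt_trans PU _; rewrite add0e -EFinD lte_fin.
have sizeR : ((2 * M).+1)%:R = 2 * M%:R + 1 :> R by rewrite -natr1 natrM.
by rewrite size_map size_iota sizeR; lra.
Qed.

(** * The critical values *)

Theorem theorem1p11 (R : realType) (d : measure_display) (T : measurableType d)
    (P : probability T R) (n : nat) (hn : (2 <= n)%N)
    (q : \bar R) (hq : (1 <= q)%E)
    (U : 'rV[int]_n -> {RV P >-> R}) (hU : iid_uniform01 U)
    (c : path_rule) :
  [/\ 0 < theta_c U q c, theta_c U q c <= theta_c' U q c
    & theta_c' U q c < 1].
Proof.
have n0 : (0 < n)%N by exact: ltnW.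
have null := percolation_null c n0 hq hU.
have [g g0 pos] := percolation_positive c hn hq hU.
set A := [set theta : R | 0 <= theta <= 1 /\ (0 < P (rmf_percolation U q c theta))%E].
set B := [set theta : R | 0 <= theta <= 1 /\ P (rmf_percolation U q c theta) = 0%E].
have t0 : 0 < (16 * n)%:R^-1 :> R by rewrite invr_gt0 ltr0n muln_gt0.
have A1 : A 1 by split; [rewrite ler01 lexx|apply: pos; lra].
have B0 : B 0 by split; [rewrite ler01 lexx|apply: null; rewrite lexx ltW].
have lbA : lbound A (16 * n)%:R^-1.
  move=> theta [/andP[th0 th1] thP]; rewrite leNgt; apply/negP => lt_th.
  by move: thP; rewrite null ?ltxx // th0 ltW.
have ubB : ubound B (1 - g).
  move=> theta [_ thP]; rewrite leNgt; apply/negP => lt_th.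
  by have := pos theta (ltW lt_th); rewrite thP ltxx.
have infA : has_inf A by split; [exists 1|exists (16 * n)%:R^-1].
have supB : has_sup B by split; [exists 0|exists (1 - g)].
split.
- by apply: lt_le_trans t0 _; apply: lb_le_inf => //; exists 1.
- rewrite /theta_c /theta_c' -/A -/B leNgt; apply/negP => lt_BA.
  pose t := (sup B + inf A) / 2.
  have tB : sup B < t by rewrite /t; lra.
  have tA : t < inf A by rewrite /t; lra.
  have sB0 : 0 <= sup B by exact: (ub_le_sup supB.2).
  have iA1 : inf A <= 1 by exact: (ge_inf infA.2).
  have t01 : 0 <= t <= 1 by apply/andP; split; lra.
  have := measure_ge0 P (rmf_percolation U q c t).
  rewrite le_eqVlt => /orP[/eqP Pt|Pt].
    by have := ub_le_sup supB.2 (conj t01 (esym Pt) : B t); lra.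
  by have := ge_inf infA.2 (conj t01 Pt : A t); lra.
- apply: (@le_lt_trans _ _ (1 - g)); last by rewrite ltrBlDr ltrDl.
  by apply: ge_sup => //; exists 0.
Qed.
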